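(* Let $\delta\in\{2\cos(\pi/k): k=4,5,6,\dots\}\cup[2,\infty)$ and let $a,b$ be real numbers with $\delta(a^2+b^2)+2ab=1$. Let $(\pi^\delta_{a,b},\mathscr H)$ be the Jones representation of Thompson's group $F$ constructed from the Temperley-Lieb-Jones planar algebra with loop parameter $\delta$ and the normalized element $aR_1+bR_2$. Then the left regular representation of $F$ is not contained in $\pi^\delta_{a,b}$. Moreover, $\pi^\delta_{a,b}$ does not admit any nonzero coefficient vanishing at infinity: if $\eta,\zeta\in\mathscr H$ are such that the function $\gamma\mapsto\langle\pi^\delta_{a,b}(\gamma)\eta,\zeta\rangle$ on $F$ is not identically zero, then this function does not tend to zero at infinity (i.e. is not in $c_0(F)$).
   Context: Thompson's group $F$ (discrete group): a binary forest with $n$ roots and $m$ leaves is a planar forest, drawn with roots at the bottom and leaves at the top (both numbered from left to right), all of whose branchings are binary; $f\circ g$ is the forest obtained by stacking $f$ on top of $g$ (roots of $f$ glued to leaves of $g$). A tree is a forest with one root. $|$ is the trivial tree, $Y$ the tree with two leaves, and $\bullet$ denotes horizontal concatenation. $F$ is the set of classes $\frac ts$ of pairs $(t,s)$ of trees with the same number of leaves, modulo the equivalence relation generated by $(t,s)\sim(f\circ t,f\circ s)$, with product $\frac ts\cdot\frac{t'}{s'}=\frac{p\circ t}{q\circ s'}$ whenever $p\circ s=q\circ t'$. Temperley-Lieb-Jones category: for $m+n$ even, $\mathrm{Rec}(m,n)$ is the complex span of non-crossing pairings (planar diagrams) of $m$ points on the bottom and $n$ points on the top of a rectangle; composition is vertical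 concatenation, each closed loop being replaced by the factor $\delta$; $\dagger$ is the antilinear reflection in a horizontal line; $\bullet$ is horizontal concatenation. One takes the quotient by the kernel of the positive semidefinite forms, so that $\mathrm{Rec}(1,n)$ is a finite dimensional Hilbert space with $\langle x,y\rangle=y^\dagger\circ x\in \mathrm{Rec}(1,1)=\mathbb C$. Jones representation $\pi^\delta_{a,b}$: here $R_1=|\,|$ and $R_2={}^{\cup}_{\cap}$ in $\mathrm{Rec}(2,2)$. For $a,b\in\mathbb C$ with $\delta(|a|^2+|b|^2)+a\bar b+\bar a b=1$ put $R=aR_1+bR_2$; bending its bottom right string up to the top right gives the isometry $\rho=a(|\bullet\cup)+b(\cup\bullet|)\in\mathrm{Rec}(1,3)$. For the forest $f$ with $n$ roots whose only branching is one $Y$ at the $k$-th root set $\Phi(f)=\mathrm{id}_{2k-2}\bullet\rho\bullet\mathrm{id}_{2n-2k}\in\mathrm{Rec}(2n-1,2n+1)$, and extend by $\Phi(f\circ g)=\Phi(f)\circ\Phi(g)$. For a tree $t$ with $n$ leaves let $\mathfrak H_t$ be a copy, indexed by $t$, of the span in $\mathrm{Rec}(1,2n-1)$ of all $\Phi(s)$, $s$ a tree with $n$ leaves. $\mathscr H$ is the Hilbert space completion of the inductive limit of the $\mathfrak H_t$ along the isometries $\mathfrak H_t\to\mathfrak H_{f\circ t}$, $(t,\xi)\mapsto(f\circ t,\Phi(f)\circ\xi)$, and $\pi^\delta_{a,b}$ is the unitary representation determined by $\pi^\delta_{a,b}(\frac ts)(v,\xi)=(p\circ t,\Phi(q)\circ\xi)$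 where $p\circ s=q\circ v$. *)

(* Defs.v *)
From HB Require Import structures.
From Stdlib Require Import Relations.Relation_Operators.
From mathcomp Require Import all_boot all_order all_algebra.
From mathcomp Require Import all_classical all_reals all_analysis.
From mathcomp Require Import complex zify.

Set Implicit Arguments.
Unset Strict Implicit.
Unset Printing Implicit Defensive.

Import Order.TTheory GRing.Theory Num.Theory.

Inductive tree := Leaf | Node of tree & tree.

Fixpoint tree_encode (t : tree) : GenTree.tree unit :=
  if t is Node l r then GenTree.Node 0 [:: tree_encode l; tree_encode r]
  else GenTree.Leaf tt.

Fixpoint tree_decode (c : GenTree.tree unit) : tree :=
  if c is GenTree.Node _ [:: l; r] then Node (tree_decode l) (tree_decode r)
  else Leaf.

Lemma tree_encodeK : cancel tree_encode tree_decode.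
Proof. by elim=> //= l -> r ->. Qed.

HB.instance Definition _ := Countable.copy tree (can_type tree_encodeK).

Fixpoint leaves (t : tree) : nat :=
  if t is Node l r then leaves l + leaves r else 1.

Notation nleaves f := (sumn (map leaves f)).

(* [graft t f] glues the root of the i-th tree of f to the i-th leaf of t *)
Fixpoint graft (t : tree) (f : seq tree) : tree :=
  if t is Node l r then
    Node (graft l (take (leaves l) f)) (graft r (drop (leaves l) f))
  else head Leaf f.

Fixpoint stack (f g : seq tree) : seq tree :=
  if g is t :: g' then
    graft t (take (leaves t) f) :: stack (drop (leaves t) f) g'
  else [::].

Lemma take_cat_size (T : Type) (n : nat) (s1 s2 : seq T) :
  size s1 = n -> take n (s1 ++ s2) = s1.
Proof. by move=> <-; rewrite take_size_cat. Qed.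

Lemma drop_cat_size (T : Type) (n : nat) (s1 s2 : seq T) :
  size s1 = n -> drop n (s1 ++ s2) = s2.
Proof. by move=> <-; rewrite drop_size_cat. Qed.

Lemma seq_split (T : Type) (m n : nat) (s : seq T) : size s = m + n ->
  exists s1 s2, [/\ s = s1 ++ s2, size s1 = m & size s2 = n].
Proof.
move=> sz; exists (take m s), (drop m s); split; first by rewrite cat_take_drop.
  by rewrite size_take sz; case: ltnP; lia.
by rewrite size_drop sz addKn.
Qed.

Lemma nleaves_cat (f g : seq tree) : nleaves (f ++ g) = nleaves f + nleaves g.
Proof. by rewrite map_cat sumn_cat. Qed.

Lemma nleaves_nseq n : nleaves (nseq n Leaf) = n.
Proof. by elim: n => //= n ->. Qed.

Lemma leaves_graft t f : size f = leaves t -> leaves (graft t f) = nleaves f.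
Proof.
elim: t f => [|l IHl r IHr] f /=.
  by case: f => [|x [|y f]] //= _; rewrite addn0.
move=> /seq_split[f1 [f2 [-> s1 s2]]].
by rewrite take_cat_size // drop_cat_size // IHl // IHr // nleaves_cat.
Qed.

Lemma size_stack f g : size (stack f g) = size g.
Proof. by elim: g f => //= t g IH f; rewrite IH. Qed.

Lemma nleaves_stack f g :
  size f = nleaves g -> nleaves (stack f g) = nleaves f.
Proof.
elim: g f => [|t g IH] f /=; first by move/size0nil->.
move=> /seq_split[f1 [f2 [-> s1 s2]]].
by rewrite take_cat_size // drop_cat_size // leaves_graft // IH // nleaves_cat.
Qed.

Lemma stack_cat f1 f2 g1 g2 : size f1 = nleaves g1 ->
  stack (f1 ++ f2) (g1 ++ g2) = stack f1 g1 ++ stack f2 g2.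
Proof.
elim: g1 f1 => [|t g1 IH] f1 /=; first by move/size0nil->.
move=> /seq_split[h1 [h2 [-> s1 s2]]].
by rewrite -catA !take_cat_size // !drop_cat_size // IH.
Qed.

Lemma graft_stack f g t : size f = nleaves g -> size g = leaves t ->
  graft t (stack f g) = graft (graft t g) f.
Proof.
elim: t f g => [|l IHl r IHr] f g /=.
  case: g => [|u [|v g]] //= sf _; rewrite addn0 in sf.
  by rewrite take_oversize // sf.
move=> sf /seq_split[g1 [g2 [eg s1 s2]]]; move: sf.
rewrite {}eg nleaves_cat => /seq_split[f1 [f2 [-> s3 s4]]].
rewrite stack_cat // !take_cat_size ?drop_cat_size ?size_stack ?leaves_graft //.
by rewrite IHl // IHr.
Qed.

Lemma stackA f g h : size f = nleaves g -> size g = nleaves h ->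
  stack f (stack g h) = stack (stack f g) h.
Proof.
elim: h f g => //= t h IH f g.
move=> sf /seq_split[g1 [g2 [eg s1 s2]]]; move: sf.
rewrite {}eg nleaves_cat => /seq_split[f1 [f2 [-> s3 s4]]].
rewrite stack_cat // !take_cat_size ?drop_cat_size ?size_stack ?leaves_graft //.
by rewrite IH // graft_stack.
Qed.

Lemma graft_nseq t : graft t (nseq (leaves t) Leaf) = t.
Proof.
elim: t => //= l IHl r IHr.
rewrite nseqD take_cat_size ?size_nseq // drop_cat_size ?size_nseq //.
by rewrite IHl IHr.
Qed.

Lemma stack_nseqr f : stack f (nseq (size f) Leaf) = f.
Proof. by elim: f => //= t f IH; rewrite drop0 IH. Qed.

Lemma stack_nseql f : stack (nseq (nleaves f) Leaf) f = f.
Proof.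
elim: f => //= t f IH.
rewrite nseqD take_cat_size ?size_nseq // drop_cat_size ?size_nseq //.
by rewrite graft_nseq IH.
Qed.

Lemma graft_inj t f g : size f = leaves t -> size g = leaves t ->
  graft t f = graft t g -> f = g.
Proof.
elim: t f g => [|l IHl r IHr] f g /=.
  by case: f => [|x [|]] //; case: g => [|y [|]] //= _ _ ->.
move=> /seq_split[f1 [f2 [-> s1 s2]]] /seq_split[g1 [g2 [-> s3 s4]]].
rewrite !take_cat_size // !drop_cat_size // => -[/IHl -> // /IHr -> //].
Qed.

Lemma stack_inj f g h : size f = nleaves h -> size g = nleaves h ->
  stack f h = stack g h -> f = g.
Proof.
elim: h f g => [|t h IH] f g /=; first by move=> /size0nil-> /size0nil->.
move=> /seq_split[f1 [f2 [-> s1 s2]]] /seq_split[g1 [g2 [-> s3 s4]]].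
rewrite !take_cat_size // !drop_cat_size // => -[/graft_inj -> // /IH -> //].
Qed.

Lemma graft_ore s t : exists p q,
  [/\ size p = leaves s, size q = leaves t & graft s p = graft t q].
Proof.
elim: s t => [|l IHl r IHr] t.
  by exists [:: t], (nseq (leaves t) Leaf); rewrite graft_nseq size_nseq.
case: t => [|l' r'].
  exists (nseq (leaves (Node l r)) Leaf), [:: Node l r].
  by rewrite graft_nseq size_nseq.
have [p1 [q1 [s1 s2 e1]]] := IHl l'; have [p2 [q2 [s3 s4 e2]]] := IHr r'.
exists (p1 ++ p2), (q1 ++ q2); rewrite !size_cat /= s1 s2 s3 s4; split => //.
by rewrite !take_cat_size // !drop_cat_size // e1 e2.
Qed.

Lemma stack_ore f g : size f = size g -> exists p q,
  [/\ size p = nleaves f, size q = nleaves g & stack p f = stack q g].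
Proof.
elim: f g => [|t f IH] [|u g] //=; first by exists [::], [::].
move=> [/IH[p2 [q2 [s3 s4 e2]]]]; have [p1 [q1 [s1 s2 e1]]] := graft_ore t u.
exists (p1 ++ p2), (q1 ++ q2); rewrite !size_cat s1 s2 s3 s4; split => //.
by rewrite !take_cat_size // !drop_cat_size // e1 e2.
Qed.

(* n is the number of roots, m the number of leaves *)
Record forest (n m : nat) := Forest {
  branches :> seq tree;
  _ : (size branches == n) && (nleaves branches == m) }.

HB.instance Definition _ n m := [isSub for @branches n m].
HB.instance Definition _ n m := [Countable of forest n m by <:].

Lemma size_forest n m (f : forest n m) : size f = n.
Proof. by case: f => f /= /andP[/eqP]. Qed.

Lemma nleaves_forest n m (f : forest n m) : nleaves f = m.
Proof. by case: f => f /= /andP[_ /eqP]. Qed.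

Lemma fid_subproof n :
  (size (nseq n Leaf) == n) && (nleaves (nseq n Leaf) == n).
Proof. by rewrite size_nseq nleaves_nseq !eqxx. Qed.
Definition fid n : forest n n := Forest (fid_subproof n).

Lemma fcomp_subproof k n m (f : forest n m) (g : forest k n) :
  (size (stack f g) == k) && (nleaves (stack f g) == m).
Proof.
have fg : size f = nleaves g by rewrite size_forest nleaves_forest.
by rewrite size_stack nleaves_stack // size_forest nleaves_forest !eqxx.
Qed.
(* f stacked on top of g *)
Definition fcomp k n m (f : forest n m) (g : forest k n) : forest k m :=
  Forest (fcomp_subproof f g).
Arguments fid {n}.

Notation "f \of g" := (fcomp f g) (at level 40, left associativity).

Lemma fcompA k n m l (f : forest m l) (g : forest n m) (h : forest k n) :
  f \of (g \of h) = (f \of g) \of h.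
Proof.
by apply: val_inj; rewrite /= stackA ?size_forest ?nleaves_forest.
Qed.

Lemma fcomp1f n m (f : forest n m) : fid \of f = f.
Proof.
by apply: val_inj; rewrite /= -[X in nseq X](nleaves_forest f) stack_nseql.
Qed.

Lemma fcompf1 n m (f : forest n m) : f \of fid = f.
Proof.
by apply: val_inj; rewrite /= -[X in nseq X](size_forest f) stack_nseqr.
Qed.

Lemma fcompI k n m (f g : forest n m) (h : forest k n) :
  f \of h = g \of h -> f = g.
Proof.
move=> /(congr1 val) /= /stack_inj fg; apply: val_inj.
by apply: fg; rewrite ?size_forest ?nleaves_forest.
Qed.

Lemma fcomp_ore n k l (f : forest n k) (g : forest n l) :
  exists m (p : forest k m) (q : forest l m), p \of f = q \of g.
Proof.
have [|p [q [sp sq e]]] := @stack_ore f g; first by rewrite !size_forest.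
have Pp : (size p == k) && (nleaves p == nleaves p).
  by rewrite sp nleaves_forest !eqxx.
have Pq : (size q == l) && (nleaves q == nleaves p).
  rewrite sq nleaves_forest eqxx /=.
  by rewrite -(nleaves_stack sq) -e nleaves_stack.
by exists (nleaves p), (Forest Pp), (Forest Pq); apply: val_inj.
Qed.

Definition tree_pair := {n : nat & (forest 1 n * forest 1 n)%type}.

Definition tpair n (t s : forest 1 n) : tree_pair :=
  existT (fun k => (forest 1 k * forest 1 k)%type) n (t, s).

Inductive fraction_step : tree_pair -> tree_pair -> Prop :=
  FractionStep n m (t s : forest 1 n) (f : forest n m) :
    fraction_step (tpair t s) (tpair (f \of t) (f \of s)).

Definition fraction_equiv : tree_pair -> tree_pair -> Prop :=
  clos_refl_sym_trans tree_pair fraction_step.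

Definition fraction_equivb (x y : tree_pair) : bool := `[< fraction_equiv x y >].

Lemma fraction_equivb_refl : reflexive fraction_equivb.
Proof. by move=> x; apply/asboolP/rst_refl. Qed.

Lemma fraction_equivb_sym : symmetric fraction_equivb.
Proof. by move=> x y; apply/asboolP/asboolP; apply: rst_sym. Qed.

Lemma fraction_equivb_trans : transitive fraction_equivb.
Proof.
by move=> y x z /asboolP xy /asboolP yz; apply/asboolP/(rst_trans _ _ _ _ _ xy yz).
Qed.

Canonical fraction_equiv_rel := EquivRel fraction_equivb
  fraction_equivb_refl fraction_equivb_sym fraction_equivb_trans.

Definition thompsonF := {eq_quot fraction_equiv_rel}%qT.

HB.instance Definition _ := Choice.on thompsonF.

Definition frac n (t s : forest 1 n) : thompsonF := (\pi_thompsonF (tpair t s))%qT.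

Lemma frac_ex (x : thompsonF) : exists n (t s : forest 1 n), x = frac t s.
Proof.
case E : (repr x) => [n [t s]]; exists n, t, s.
by rewrite /frac -(reprK x) E.
Qed.

Lemma fracP n m (t s : forest 1 n) (t' s' : forest 1 m) :
  frac t s = frac t' s' <->
  exists k (p : forest n k) (q : forest m k), p \of t = q \of t' /\ p \of s = q \of s'.
Proof.
split=> [/eqmodP/asboolP|[k [p [q [et es]]]]]; last first.
  apply/eqmodP/asboolP; apply: (@rst_trans _ _ _ (tpair (p \of t) (p \of s))).
    exact/rst_step/FractionStep.
  by rewrite et es; apply/rst_sym/rst_step/FractionStep.
pose P (x y : tree_pair) := exists k (p : forest (projT1 x) k) (q : forest (projT1 y) k),
  p \of (projT2 x).1 = q \of (projT2 y).1 /\ p \of (projT2 x).2 = q \of (projT2 y).2.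
move=> e; suff: P (tpair t s) (tpair t' s') by [].
elim: e => {n m t s t' s'} [_ _ [n m t s f]|x|x y _|x y z _ + _].
- by exists m, f, fid; rewrite !fcomp1f.
- by exists (projT1 x), fid, fid.
- by move=> [k [p [q [e1 e2]]]]; exists k, q, p.
- move=> [k [p [q [e1 e2]]]] [l [p' [q' [e3 e4]]]].
  have [m [u [v uv]]] := fcomp_ore q p'.
  exists m, (u \of p), (v \of q').
  by rewrite -!fcompA e1 e2 -e3 -e4 !fcompA uv.
Qed.

Lemma frac_stack n m (t s : forest 1 n) (f : forest n m) :
  frac (f \of t) (f \of s) = frac t s.
Proof. by apply/fracP; exists m, fid, f; rewrite !fcomp1f. Qed.

Definition is_product (x y z : thompsonF) : Prop :=
  exists n k m (t s : forest 1 n) (t' s' : forest 1 k)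
         (p : forest n m) (q : forest k m),
    [/\ x = frac t s, y = frac t' s', p \of s = q \of t' &
        z = frac (p \of t) (q \of s')].

Lemma frac_common (x y : thompsonF) :
  exists n (a b c : forest 1 n), x = frac a b /\ y = frac b c.
Proof.
have [n [t [s ->]]] := frac_ex x; have [m [t' [s' ->]]] := frac_ex y.
have [k [p [q e]]] := fcomp_ore s t'.
exists k, (p \of t), (p \of s), (q \of s'); split; first by rewrite frac_stack.
by rewrite e frac_stack.
Qed.

Lemma is_product_ex x y : exists z, is_product x y z.
Proof.
have [n [a [b [c [-> ->]]]]] := frac_common x y.
by exists (frac a c), n, n, n, a, b, b, c, fid, fid; rewrite !fcomp1f.
Qed.

Lemma is_product_mid n (a b c : forest 1 n) z :
  is_product (frac a b) (frac b c) z -> z = frac a c.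
Proof.
move=> [k [l [m [t [s [t1 [s1 [p [q]]]]]]]]].
move=> [/fracP[i [v [u [at_ bs]]]] /fracP[j [v1 [u1 [bt1 cs1]]]] e ->].
have [d [G [G' GG]]] := fcomp_ore p u.
have [d' [H [H' HH]]] := fcomp_ore (G \of q) u1.
have vv : H' \of v1 = (H \of G') \of v.
  apply: (@fcompI _ _ _ _ _ b).
  by rewrite -!fcompA bt1 bs !fcompA -HH -!fcompA -e !fcompA -(fcompA H) GG !fcompA.
rewrite -(frac_stack _ _ (H \of G)) -(frac_stack a c (H \of G' \of v)).
congr frac.
  by rewrite -!fcompA at_ !fcompA -(fcompA H) GG !fcompA.
by rewrite -vv -[RHS]fcompA cs1 !fcompA -HH !fcompA.
Qed.

Definition mulF (x y : thompsonF) : thompsonF := xget x [set z | is_product x y z].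

Definition oneF : thompsonF := frac (@fid 1) fid.

Definition invF (x : thompsonF) : thompsonF :=
  frac (projT2 (repr x)).2 (projT2 (repr x)).1.

Lemma mulF_mid n (a b c : forest 1 n) : mulF (frac a b) (frac b c) = frac a c.
Proof.
apply: is_product_mid.
exact: (@xgetPex _ _ [set z | is_product _ _ z]) (is_product_ex _ _).
Qed.

Lemma mulFE n k m (t s : forest 1 n) (t' s' : forest 1 k)
    (p : forest n m) (q : forest k m) :
  p \of s = q \of t' -> mulF (frac t s) (frac t' s') = frac (p \of t) (q \of s').
Proof.
by move=> e; rewrite -(frac_stack t s p) -(frac_stack t' s' q) e mulF_mid.
Qed.

Lemma frac_refl n (t : forest 1 n) : frac t t = oneF.
Proof. by rewrite /oneF -(frac_stack fid fid t) !fcompf1. Qed.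

Lemma invFE n (t s : forest 1 n) : invF (frac t s) = frac s t.
Proof.
rewrite /invF; case E : (repr (frac t s)) => [m [t' s']] /=.
have /fracP[k [p [q [et es]]]] : frac t s = frac t' s'.
  by rewrite -[LHS]reprK E.
by apply/fracP; exists k, q, p.
Qed.

Lemma mulFA : associative mulF.
Proof.
move=> x y z; have [n [a [b [c [-> ->]]]]] := frac_common x y.
have [m [t [s ->]]] := frac_ex z; have [k [p [q e]]] := fcomp_ore c t.
rewrite -(frac_stack a b p) -(frac_stack b c p) -(frac_stack t s q).
by rewrite -e !mulF_mid.
Qed.

Lemma mul1F : left_id oneF mulF.
Proof.
by move=> x; have [n [t [s ->]]] := frac_ex x; rewrite -(frac_refl t) mulF_mid.
Qed.

Lemma mulF1 : right_id oneF mulF.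
Proof.
by move=> x; have [n [t [s ->]]] := frac_ex x; rewrite -(frac_refl s) mulF_mid.
Qed.

Lemma mulVF : left_inverse oneF invF mulF.
Proof.
move=> x; have [n [t [s ->]]] := frac_ex x.
by rewrite invFE mulF_mid frac_refl.
Qed.

Lemma mulFV : right_inverse oneF invF mulF.
Proof.
move=> x; have [n [t [s ->]]] := frac_ex x.
by rewrite invFE mulF_mid frac_refl.
Qed.

HB.instance Definition _ := isGroup.Build thompsonF mulFA mul1F mulF1 mulVF mulFV.

Lemma frac_mul n k m (t s : forest 1 n) (t' s' : forest 1 k)
    (p : forest n m) (q : forest k m) : p \of s = q \of t' ->
  (frac t s * frac t' s')%g = frac (p \of t) (q \of s').
Proof. exact: mulFE. Qed.

Local Open Scope ring_scope.
Local Open Scope complex_scope.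

(* Boundary points of a rectangle with m points on the bottom (inl) and n on
   the top (inr); [bpos] is the position counterclockwise from the bottom left
   corner. *)
Notation boundary m n := ('I_m + 'I_n)%type.

Definition bpos m n (u : boundary m n) : nat :=
  match u with inl i => i | inr j => (m + rev_ord j)%N end.

Definition noncrossing_pairing m n (d : {ffun boundary m n -> boundary m n}) :=
  [&& [forall u, d u != u], [forall u, d (d u) == u] &
      ~~ [exists u, exists v,
           [&& bpos u < bpos v, bpos v < bpos (d u) & bpos (d u) < bpos (d v)]%N]].

Record diagram (m n : nat) := Diagram {
  pairing :> {ffun boundary m n -> boundary m n};
  _ : noncrossing_pairing pairing }.

HB.instance Definition _ m n := [isSub for @pairing m n].
HB.instance Definition _ m n := [Finite of diagram m n by <:].

Notation Rec R m n := {ffun diagram m n -> R[i]}.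

Definition swap_sum (A B : Type) (u : A + B) : B + A :=
  match u with inl x => inr x | inr y => inl y end.

Definition is_flip m n (d : diagram m n) (c : diagram n m) : bool :=
  [forall u, c (swap_sum u) == swap_sum (d u)].

Definition is_id n (d : diagram n n) : bool :=
  [forall i, d (inl i) == inr i].

Definition hcat_l m n m' n' (u : boundary m n) : boundary (m + m') (n + n') :=
  match u with inl i => inl (lshift m' i) | inr j => inr (lshift n' j) end.

Definition hcat_r m n m' n' (u : boundary m' n') : boundary (m + m') (n + n') :=
  match u with inl i => inl (rshift m i) | inr j => inr (rshift n j) end.

Definition is_hcat m n m' n' (d : diagram m n) (e : diagram m' n')
    (c : diagram (m + m') (n + n')) : bool :=
  [forall u, c (hcat_l m' n' u) == hcat_l m' n' (d u)] &&
  [forall u, c (hcat_r m n u) == hcat_r m n (e u)].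

Section Gluing.
Variables (m n p : nat) (e : diagram n p) (d : diagram m n).

(* the points of the picture of e on top of d: bottom, middle, top *)
Definition glued := ('I_m + 'I_n + 'I_p)%type.

Definition glue_lower (u : boundary m n) : glued := inl u.

Definition glue_upper (u : boundary n p) : glued :=
  match u with inl i => inl (inr i) | inr j => inr j end.

Definition glue_outer (u : boundary m p) : glued :=
  match u with inl i => inl (inl i) | inr j => inr j end.

Definition glue_rel : rel glued := fun x y =>
  [exists u, (x == glue_lower u) && (y == glue_lower (d u))] ||
  [exists u, (x == glue_upper u) && (y == glue_upper (e u))].

(* Characterizes the pairing obtained by erasing the closed loops of the
   picture; exactly one diagram c satisfies it. *)
Definition is_composite (c : diagram m p) : bool :=
  [forall u, forall v,
    (c u == v) == (u != v) && connect glue_rel (glue_outer u) (glue_outer v)].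

Definition nloops : nat :=
  n_comp glue_rel [pred x | ~~ [exists u, connect glue_rel x (glue_outer u)]].

End Gluing.

Section TemperleyLieb.
Variables (R : realType) (delta : R).

Definition id_Rec n : Rec R n n := [ffun d => (is_id d)%:R].

Definition comp_Rec m n p (y : Rec R n p) (x : Rec R m n) : Rec R m p :=
  [ffun c => \sum_e \sum_d
    y e * x d * delta%:C ^+ nloops e d * (is_composite e d c)%:R].

Definition dagger m n (x : Rec R m n) : Rec R n m :=
  [ffun c => \sum_d (x d)^* * (is_flip d c)%:R].

Definition hcat m n m' n' (x : Rec R m n) (y : Rec R m' n') :
    Rec R (m + m') (n + n') :=
  [ffun c => \sum_d \sum_e x d * y e * (is_hcat d e c)%:R].

Definition cup : Rec R 0 2 := [ffun d : diagram 0 2 => (d (inr ord0) == inr ord_max)%:R].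

(* the identification of Rec(1,1) with C
   (diagram 1 1 has exactly one element) *)
Definition scalar_Rec (x : Rec R 1 1) : R[i] := \sum_d x d.

Definition inner n (x y : Rec R 1 n) : R[i] :=
  scalar_Rec (comp_Rec (dagger y) x).

(* the element a R_1 + b R_2 with its bottom right string bent to the top right *)
Definition rho (a b : R[i]) : Rec R 1 3 :=
  a *: (hcat (id_Rec 1) cup : Rec R 1 3) + b *: (hcat cup (id_Rec 1) : Rec R 1 3).

Definition cast_Rec m n m' n' (em : m = m') (en : n = n') (x : Rec R m n) :
    Rec R m' n' :=
  ecast k (Rec R k n') em (ecast k (Rec R m k) en x).

Lemma caret_subproof i j (f := nseq i Leaf ++ Node Leaf Leaf :: nseq j Leaf) :
  (size f == (i + j).+1) && (nleaves f == (i + j).+2).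
Proof.
rewrite /f size_cat /= !size_nseq nleaves_cat /= !nleaves_nseq.
by apply/andP; split; apply/eqP; lia.
Qed.
(* the forest with i + 1 + j roots whose only branching is at the root i + 1 *)
Definition caret i j : forest (i + j).+1 (i + j).+2 := Forest (caret_subproof i j).

Lemma strands_bot i j : (i.*2 + (1 + j.*2) = (i + j).+1.*2.-1)%N.
Proof. lia. Qed.

Lemma strands_top i j : (i.*2 + (3 + j.*2) = (i + j).+2.*2.-1)%N.
Proof. lia. Qed.

Definition Phi_caret (a b : R[i]) i j :
    Rec R (i + j).+1.*2.-1 (i + j).+2.*2.-1 :=
  cast_Rec (strands_bot i j) (strands_top i j)
    (hcat (id_Rec i.*2) (hcat (rho a b) (id_Rec j.*2))).

(* Every forest is a composition of forests [caret i j], so these conditions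
   determine Phi. *)
Record forest_functor (a b : R[i])
    (Phi : forall n m, forest n m -> Rec R n.*2.-1 m.*2.-1) : Prop := {
  Phi_fid : forall n, Phi n n fid = id_Rec _;
  Phi_fcomp : forall k n m (f : forest n m) (g : forest k n),
    Phi k m (f \of g) = comp_Rec (Phi n m f) (Phi k n g);
  Phi_caretE : forall i j, Phi _ _ (caret i j) = Phi_caret a b i j }.

(* the span of the Phi(s), s a tree with n leaves *)
Definition tree_span (Phi : forall n m, forest n m -> Rec R n.*2.-1 m.*2.-1) n
    (x : Rec R 1 n.*2.-1) : Prop :=
  exists k (c : 'I_k -> R[i]) (s : 'I_k -> forest 1 n),
    x = \sum_(i < k) c i *: Phi 1 n (s i).

End TemperleyLieb.

Section Hilbert.
Variables (R : realType) (H : lmodType R[i]) (ip : {dot H for Num.conj}).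

Definition hnorm (x : H) : R := Num.sqrt (complex.Re (ip x x)).

Definition hcomplete : Prop :=
  forall u : nat -> H,
    (forall eps : R, 0 < eps -> exists N, forall m n,
      (N <= m)%N -> (N <= n)%N -> hnorm (u m - u n) < eps) ->
    exists l : H, forall eps : R, 0 < eps -> exists N, forall n,
      (N <= n)%N -> hnorm (u n - l) < eps.

Definition unitary_rep (G : groupType) (pi : G -> H -> H) : Prop :=
  [/\ forall g c x y, pi g (c *: x + y) = c *: pi g x + pi g y,
      forall g x y, ip (pi g x) (pi g y) = ip x y,
      forall x, pi 1%g x = x &
      forall g h x, pi (g * h)%g x = pi g (pi h x)].

End Hilbert.

(* the modulus as an element of R; the library's `|z| has type R[i] *)
Definition cabs (R : realType) (z : R[i]) : R := complex.Re `|z|.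

Section Coefficients.
Variables (R : realType) (G : groupType).

Definition l2norm2 (f : G -> R[i]) : \bar R :=
  \esum_(g in [set: G]) (cabs (f g) ^+ 2)%:E.

Definition l2 (f : G -> R[i]) : Prop := (l2norm2 f < +oo)%E.

Definition left_translate (g : G) (f : G -> R[i]) : G -> R[i] :=
  fun h => f (g^-1 * h)%g.

Definition contains_left_regular (H : lmodType R[i])
    (ip : {dot H for Num.conj}) (pi : G -> H -> H) : Prop :=
  exists V : (G -> R[i]) -> H,
  [/\ forall c f f', l2 f -> l2 f' ->
        V (fun g => c * f g + f' g) = c *: V f + V f',
      forall f, l2 f -> ip (V f) (V f) = (fine (l2norm2 f))%:C &
      forall g f, l2 f -> V (left_translate g f) = pi g (V f)].

Definition c0 (f : G -> R[i]) : Prop :=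
  forall eps : R, 0 < eps -> finite_set [set g | eps <= cabs (f g)].

End Coefficients.

(* [jones_iota t] is the canonical map from H_t to the completed inductive
   limit. H_t is represented by unreduced elements of Rec(1, 2n - 1): an
   isometric map factors through the quotient by the kernel of the form, and
   the form is positive semidefinite on H_t because [jones_ip] is. Isometry,
   compatibility and density determine the space up to unitary equivalence. *)
Record jones_rep (R : realType) (delta : R) (a b : R[i]) := JonesRep {
  jones_Phi : forall n m, forest n m -> Rec R n.*2.-1 m.*2.-1;
  jones_functor : forest_functor delta a b jones_Phi;
  jones_space : lmodType R[i];
  jones_ip : {dot jones_space for Num.conj};
  jones_complete : hcomplete jones_ip;
  jones_iota : forall n, forest 1 n -> Rec R 1 n.*2.-1 -> jones_space;
  jones_iota_linear : forall n (t : forest 1 n) c x y,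
    tree_span jones_Phi x -> tree_span jones_Phi y ->
    jones_iota t (c *: x + y) = c *: jones_iota t x + jones_iota t y;
  jones_iota_isometric : forall n (t : forest 1 n) x y,
    tree_span jones_Phi x -> tree_span jones_Phi y ->
    jones_ip (jones_iota t x) (jones_iota t y) = inner delta x y;
  jones_iota_compatible : forall n m (t : forest 1 n) (f : forest n m) x,
    tree_span jones_Phi x ->
    jones_iota (f \of t) (comp_Rec delta (jones_Phi f) x) = jones_iota t x;
  jones_iota_dense : forall (v : jones_space) (eps : R), 0 < eps ->
    exists n (t : forest 1 n) x,
      tree_span jones_Phi x /\ hnorm jones_ip (v - jones_iota t x) < eps;
  jones_pi : thompsonF -> jones_space -> jones_space;
  jones_pi_unitary : unitary_rep jones_ip jones_pi;
  jones_pi_frac : forall n k m (t s : forest 1 n) (v : forest 1 k)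
      (p : forest n m) (q : forest k m) x,
    p \of s = q \of v -> tree_span jones_Phi x ->
    jones_pi (frac t s) (jones_iota v x) =
      jones_iota (p \of t) (comp_Rec delta (jones_Phi q) x) }.

Definition jones_parameter (R : realType) (delta : R) : Prop :=
  (exists k : nat, (4 <= k)%N /\ delta = 2 * cos (pi / k%:R)) \/ 2 <= delta.

Arguments jones_pi {R delta a b} j _ _.

(* Main.v *)
(** Let [g0] be an element of F given by two trees [T], [S] and [kappa] its
    coefficient at the vacuum vector. If [T/S] acts below one leaf of a tree [v],
    planarity gives [<pi g x, y> = kappa <x, y>] for all [x], [y] in the space of
    [v], since the part of the picture above that leaf is a multiple [kappa] of a
    single strand. There are infinitely many such [g], and every vector is
    approximated by vectors in the space of some tree, so a nonzero coefficient
    stays away from 0 on an infinite set as soon as [kappa <> 0].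

    For [T = (.(.Y))] and [S = ((.Y).)] one finds
    [kappa = 1 - a^2 b^2 (delta^2 - 1) (2 - delta a^2)], and the mirror images
    exchange [a] and [b]; these two values do not both vanish. The left regular
    representation has a nonzero coefficient with finite support.

    Loops are counted on half diagrams: a diagram in Rec(1, n) is coded by an
    involution on points, branching inserts an arc joining two neighbouring
    points, and contracting two neighbours is adjoint to inserting an arc. *)

From mathcomp Require Import all_boot all_order all_algebra.
From mathcomp Require Import all_classical all_reals all_analysis.
From mathcomp Require Import complex zify ring lra.
Require Import Defs.

Set Implicit Arguments.
Unset Strict Implicit.
Unset Printing Implicit Defensive.

Import Order.TTheory GRing.Theory Num.Theory.

(** * Insertion and contraction of arcs *)

(** The obvious candidate for [g0] has three leaves: [(.Y)] over [(Y.)]. Its coefficient is $1 -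
    a^2b^2(\delta^2-1)$, which vanishes for some admissible parameters, for instance $\delta = \sqrt
    2$, $ab = -1$, $a^2+b^2 = 3/\sqrt 2$. Being symmetric in $a$ and $b$, it vanishes for the mirror
    image as well. With a fourth leaf the factor $2 - \delta a^2$ breaks the symmetry, so that an
    element and its mirror image give two different equations to set against the relation between
    $a$ and $b$.

    The scalar is extracted without cutting the picture. Each side carries three insertions, with
    two choices at each, and for all 64 pairs of states the insertions of one side cancel those of
    the other. The cancellation never consults the diagrams of $x$ and $y$, so the change in the
    number of loops depends on the pair of states alone and is found by computation. *)

Section Transfer.
Variables (T T' : finType) (e : rel T) (e' : rel T') (a : {pred T}).
Variables (h : T' -> T) (r : T -> T').
Hypotheses (e_sym : symmetric e) (e'_sym : symmetric e').
Hypotheses (cl_a : fingraph.closed e a) (h_a : forall x, h x \in a).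
Hypothesis h_step : forall x y, e' x y -> connect e (h x) (h y).
Hypothesis r_step : forall x y, x \in a -> e x y -> connect e' (r x) (r y).
Hypothesis hK : cancel h r.
Hypothesis unit_r : forall x, x \in a -> connect e x (h (r x)).

(** Both maps send edges to paths, hence paths to paths, and [hK] makes the image under [r] of a
    path from [h x] to [h y] run from [x] to [y]. Closedness of [a] keeps that path where [r_step]
    applies. *)
Lemma connect_retract x y : connect e' x y = connect e (h x) (h y).
Proof.
apply/idP/idP.
  move=> /connectP[p + ->]; elim: p x => [|z p IH] x /=; first by rewrite connect0.
  by move=> /andP[/h_step xz /IH]; apply: connect_trans.
suff H u v : u \in a -> connect e u v -> connect e' (r u) (r v).
  by move=> /H; rewrite !hK; apply.
move=> + /connectP[p + ->]; elim: p u => [|z p IH] u ua /=.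
  by rewrite connect0.
move=> /andP[uz /IH H]; apply: connect_trans (r_step ua uz) _.
by apply: H; rewrite -(cl_a uz).
Qed.

(** By [unit_r] every component inside [a] meets the image of [h], and by [connect_retract] distinct
    components stay distinct. [P] selects whole components. *)
Lemma n_comp_retract (P : pred T) (P' : pred T') :
  (forall x y, e x y -> P x = P y) -> (forall x, P (h x) = P' x) ->
  n_comp e [predI a & P] = n_comp e' P'.
Proof.
move=> clP hP; rewrite (@adjunction_n_comp _ _ h e e') //.
- by apply: eq_n_comp_r => x; rewrite /in_mem /= -[a _]/(_ \in a) h_a -[P _]/(P (h x)) hP.
- exact: sym_connect_sym.
- exact: sym_connect_sym.
- by move=> x y xy; rewrite !inE (cl_a xy); congr andb; apply: clP.
split=> [x|x y _]; last exact: connect_retract.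
by rewrite !inE => /andP[xa _]; exists (r x); apply: unit_r.
Qed.
End Transfer.

Ltac ifs :=
  repeat match goal with
  | |- context [if ?b then _ else _] =>
      lazymatch b with
      | context [if _ then _ else _] => fail
      | _ => let E := fresh in case E : b
      end
  end; lia.

(** Renumbering of the old points when two new ones take the places [j] and [j.+1]. The value of
    [unskip], its inverse, is meaningless at these two places. *)
Definition skip j x := if x < j then x else x.+2.
Definition unskip j x := if x < j then x else x - 2.

Definition insert_arc j (K : nat -> nat) x :=
  if x == j then j.+1 else if x == j.+1 then j else skip j (K (unskip j x)).

(* Joins the partners of j and j + 1 and removes these two points. *)
Definition contract_arc j (K : nat -> nat) x :=
  let y := K (skip j x) in
  unskip j (if y == j then K j.+1 else if y == j.+1 then K j else y).


Lemma skipK j : cancel (skip j) (unskip j).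
Proof. by move=> x; rewrite /unskip /skip; case: (ltnP x j) => [->//|?]; ifs. Qed.

Variant skip_spec j : nat -> Type :=
| SkipFst : skip_spec j j
| SkipSnd : skip_spec j j.+1
| SkipOut z : skip_spec j (skip j z).

Lemma skipP j x : skip_spec j x.
Proof.
have [->|xj] := eqVneq x j; first exact: SkipFst.
have [->|xj1] := eqVneq x j.+1; first exact: SkipSnd.
suff -> : x = skip j (unskip j x) by exact: SkipOut.
by rewrite /skip /unskip; case: (ltnP x j) => [->//|?]; ifs.
Qed.

Lemma skip_neq j x : ((skip j x == j) = false) * ((skip j x == j.+1) = false).
Proof. by split; rewrite /skip; ifs. Qed.

Lemma insert_fst j K : insert_arc j K j = j.+1.
Proof. by rewrite /insert_arc eqxx. Qed.

Lemma insert_snd j K : insert_arc j K j.+1 = j.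
Proof. by rewrite /insert_arc eqxx; case: ifP => // /eqP; lia. Qed.

Lemma insert_skip j K x : insert_arc j K (skip j x) = skip j (K x).
Proof. by rewrite /insert_arc !skip_neq skipK. Qed.

Definition insertE := (insert_fst, insert_snd, insert_skip).

Lemma skip_lt j x : x < j -> skip j x = x.
Proof. by rewrite /skip => ->. Qed.

Lemma skip_ge j x : j <= x -> skip j x = x.+2.
Proof. by rewrite /skip ltnNge => ->. Qed.

Lemma skipC j l x : j <= l -> skip j (skip l x) = skip l.+2 (skip j x).
Proof. by rewrite /skip => jl; ifs. Qed.

Lemma skip_eq j x y : (skip j x == skip j y) = (x == y).
Proof. exact/inj_eq/can_inj/skipK. Qed.

(** For positive [j] this holds even at the meaningless values [x = j] and [x = j.+1], so
    [contract_insert_gt] asks nothing of [K]; at [j = 0] the truncated subtraction spoils it. *)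
Lemma unskip_skip_gt j l x : 0 < j <= l -> unskip j (skip l.+2 x) = skip l (unskip j x).
Proof.
by rewrite /skip /unskip => jl; ifs.
Qed.

Lemma unskip_skip_lt j l x : l <= j -> x != j -> x != j.+1 ->
  unskip j.+2 (skip l x) = skip l (unskip j x).
Proof.
by rewrite /skip /unskip => jl nj nj1; ifs.
Qed.

Lemma contract_insert_gt j l K : 0 < j <= l ->
  contract_arc j (insert_arc l.+2 K) = insert_arc l (contract_arc j K).
Proof.
move=> /andP[j0 jl]; apply/funext => x; rewrite /contract_arc.
case: (skipP l x) => [||z].
- rewrite insertE skip_ge 1?insertE; last by lia.
  by rewrite /unskip; ifs.
- rewrite insertE skip_ge 1?insertE; last by lia.
  by rewrite /unskip; ifs.
have sj : skip l.+2 j = j by rewrite skip_lt //; lia.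
have sj1 : skip l.+2 j.+1 = j.+1 by rewrite skip_lt //; lia.
have skip_eqj y : (skip l.+2 y == j) = (y == j) by rewrite -[in LHS]sj skip_eq.
have skip_eqj1 y : (skip l.+2 y == j.+1) = (y == j.+1) by rewrite -[in LHS]sj1 skip_eq.
have insj : insert_arc l.+2 K j = skip l.+2 (K j) by rewrite -[in LHS]sj insertE.
have insj1 : insert_arc l.+2 K j.+1 = skip l.+2 (K j.+1) by rewrite -[in LHS]sj1 insertE.
rewrite insertE skipC // insertE skip_eqj skip_eqj1 insj insj1.
by rewrite -unskip_skip_gt ?j0 //; case: ifP => // _; case: ifP.
Qed.

(** On this side the meaningless values of [unskip] would matter. Injectivity and the absence of
    fixed points at [j] and [j.+1] keep the new partner of a surviving point away from the removed
    pair. *)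
Lemma contract_insert_lt j l K : l <= j -> injective K ->
    K j != j -> K j.+1 != j.+1 ->
  contract_arc j.+2 (insert_arc l K) = insert_arc l (contract_arc j K).
Proof.
move=> lj Kinj fixj fixj1; apply/funext => x; rewrite /contract_arc.
case: (skipP l x) => [||z].
- rewrite insertE skip_lt 1?insertE; last by lia.
  by rewrite /unskip; ifs.
- rewrite insertE skip_lt 1?insertE; last by lia.
  by rewrite /unskip; ifs.
have sj : skip l j = j.+2 by rewrite skip_ge.
have sj1 : skip l j.+1 = j.+3 by rewrite skip_ge // leqW.
have skip_eqj y : (skip l y == j.+2) = (y == j) by rewrite -sj skip_eq.
have skip_eqj1 y : (skip l y == j.+3) = (y == j.+1) by rewrite -sj1 skip_eq.
have insj : insert_arc l K j.+2 = skip l (K j) by rewrite -sj insertE.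
have insj1 : insert_arc l K j.+3 = skip l (K j.+1) by rewrite -sj1 insertE.
rewrite insertE -skipC // insertE skip_eqj skip_eqj1 insj insj1 -!fun_if.
have [zj zj1] := skip_neq j z.
rewrite unskip_skip_lt //; case: ifPn => [/eqP Kz|nKz] //;
  try case: ifPn => [/eqP Kz1|nKz1] //.
- by apply/eqP => KE; move: zj1; rewrite (Kinj _ _ (etrans Kz (esym KE))) eqxx.
- by apply/eqP => KE; move: zj; rewrite (Kinj _ _ (etrans Kz1 (esym KE))) eqxx.
Qed.

(** Zigzag relation: the inserted arc joins [j.+1] to [j.+2], so the contraction only moves the end
    of an old strand from [j] to [j.+2], which is then renumbered [j]. The next lemma is its mirror
    image. *)
Lemma contract_insert_succ j K : K j != j ->
  contract_arc j (insert_arc j.+1 K) = K.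
Proof.
move=> fixj; apply/funext => x; rewrite /contract_arc.
have insj : insert_arc j.+1 K j = skip j.+1 (K j).
  by have := insert_skip j.+1 K j; rewrite (@skip_lt j.+1 j).
have unskipj y : y != j -> unskip j (skip j.+1 y) = y.
  by move=> /eqP yj; rewrite /unskip /skip; case: (ltnP y j.+1); ifs.
have [->|xj] := eqVneq x j.
  by rewrite skip_ge // insertE eqxx insj; case: ifP => [/eqP|_]; [lia | exact: unskipj].
have -> : skip j x = skip j.+1 x.
  by move/eqP: xj; rewrite /skip; ifs.
rewrite insertE insj !insertE.
have [->|Kxj] := eqVneq (K x) j.
  rewrite skip_lt // eqxx /unskip; ifs.
rewrite skip_neq; case: ifP => [/eqP|_]; last exact: unskipj.
by move/eqP: Kxj; rewrite /skip; ifs.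
Qed.

Lemma contract_insert_pred j K : K j != j ->
  contract_arc j.+1 (insert_arc j K) = K.
Proof.
move=> fixj; apply/funext => x; rewrite /contract_arc.
have insj : insert_arc j K j.+2 = skip j (K j).
  by have := insert_skip j K j; rewrite (@skip_ge j j).
have unskipj y : y != j -> unskip j.+1 (skip j y) = y.
  by move=> /eqP yj; rewrite /unskip /skip; case: (ltnP y j); ifs.
have [->|xj] := eqVneq x j.
  by rewrite skip_lt // insertE insj eqxx unskipj.
have -> : skip j.+1 x = skip j x.
  by move/eqP: xj; rewrite /skip; ifs.
rewrite insertE insj !insertE skip_neq.
have [->|Kxj] := eqVneq (K x) j.
  rewrite skip_ge // eqxx /unskip; ifs.
case: ifP => [/eqP|_]; last exact: unskipj.
by move/eqP: Kxj; rewrite /skip; ifs.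
Qed.

Lemma insert_insert j l K : j <= l ->
  insert_arc j (insert_arc l K) = insert_arc l.+2 (insert_arc j K).
Proof.
move=> jl; apply/funext => x.
have sj : skip l.+2 j = j by rewrite skip_lt //; lia.
have sj1 : skip l.+2 j.+1 = j.+1 by rewrite skip_lt //; lia.
case: (skipP j x) => [||z].
- by have := insert_skip l.+2 (insert_arc j K) j; rewrite sj => ->; rewrite !insertE sj1.
- by have := insert_skip l.+2 (insert_arc j K) j.+1; rewrite sj1 => ->; rewrite !insertE sj.
have sl : skip j l = l.+2 by rewrite skip_ge.
have sl1 : skip j l.+1 = l.+3 by rewrite skip_ge // leqW.
case: (skipP l z) => [||w].
- by rewrite insertE insertE sl sl1 insertE.
- by rewrite insertE insertE sl sl1 insertE.
by rewrite insertE insertE !(skipC _ jl) !insertE.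
Qed.

(* The points of a closed picture: 0 and 1 code the top and bottom outer points,
   and k + 2 the middle point k. L fixes 0 and K fixes 1. *)
Definition arcs m (L K : nat -> nat) : rel 'I_m.+2 :=
  fun x y => (y == L x :> nat) || (y == K x :> nat).

Definition outer m (L K : nat -> nat) (x : 'I_m.+2) : bool :=
  connect (@arcs m L K) x ord0 || connect (@arcs m L K) x (inord 1).

Definition loops m (L K : nat -> nat) : nat :=
  n_comp (@arcs m L K) [predC @outer m L K].

Definition through m (L K : nat -> nat) : bool :=
  connect (@arcs m L K) ord0 (inord 1).

(** The last clause exempts 0 and 1 because each diagram has one outer point and fixes the code of
    the other. *)
Definition arc_system m (K : nat -> nat) : Prop :=
  [/\ involutive K, forall x, x < m.+2 -> K x < m.+2 &
      forall x, 1 < x < m.+2 -> K x != x].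

Lemma arcs_sym m L K : involutive L -> involutive K -> symmetric (@arcs m L K).
Proof.
move=> LK KK x y; rewrite /arcs -(can_eq LK) -(can_eq KK y) LK KK.
by rewrite ![_ == x :> nat]eq_sym.
Qed.

Lemma skip_bound j m x : j <= m -> (skip j x < m.+2) = (x < m).
Proof. by rewrite /skip => jm; ifs. Qed.

Lemma insert_arc_system m j K : 1 < j -> j <= m.+2 -> arc_system m K ->
  arc_system m.+2 (insert_arc j K).
Proof.
move=> j1 jm [KK Km Kfix]; split => [x|x|x].
- by case: (skipP j x) => [||z]; rewrite !insertE ?KK.
- case: (skipP j x) => [||z]; rewrite !insertE; try lia.
  by rewrite !skip_bound //; apply: Km.
- case: (skipP j x) => [||z]; rewrite !insertE; try lia.
  rewrite skip_bound // skip_eq => /andP[z1 zm]; apply: Kfix; rewrite zm andbT.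
  by move: z1 j1; rewrite /skip; ifs.
Qed.

Lemma outer_step m L K x y : involutive L -> involutive K ->
  @arcs m L K x y -> outer L K x = outer L K y.
Proof.
move=> LK KK xy; have csym := sym_connect_sym (@arcs_sym m _ _ LK KK).
by rewrite /outer !(same_connect csym (connect1 xy)).
Qed.

Lemma skip_unskip j x : x != j -> x != j.+1 -> skip j (unskip j x) = x.
Proof. by case: (skipP j x) => [||z]; rewrite ?eqxx // skipK. Qed.

Lemma outer_closed m L K : involutive L -> involutive K ->
  fingraph.closed (@arcs m L K) [predC @outer m L K].
Proof. by move=> LK KK x y xy; congr negb; apply: outer_step xy. Qed.

Section Insertion.
Variables (m j : nat) (L : nat -> nat).
Hypotheses (j1 : 1 < j) (jm : j <= m.+2) (sysL : arc_system m L).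

Let h (x : 'I_m.+2) : 'I_m.+2.+2 := inord (skip j x).

Let hE x : h x = skip j x :> nat.
Proof. by rewrite inordK // skip_bound ?ltn_ord. Qed.

Let h0 : h ord0 = ord0.
Proof. by apply: val_inj; rewrite /= hE skip_lt //= ltnW. Qed.

Let h1 : h (inord 1) = inord 1.
Proof. by apply: val_inj; rewrite /= hE !inordK // skip_lt. Qed.

(** A path through the inserted arc visits the partner of [j], then [j], [j.+1] and the partner of
    [j.+1]; the contraction replaces this detour by one edge. Since [K j != j.+1], the detour is not
    itself a loop. *)
Lemma loops_contract K : arc_system m.+2 K -> K j != j.+1 ->
    arc_system m (contract_arc j K) ->
  loops m.+2 (insert_arc j L) K = loops m L (contract_arc j K) /\
  through m.+2 (insert_arc j L) K = through m L (contract_arc j K).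
Proof.
move=> [KK Km Kfix] Kj [CK _ _].
have [LK Lm _] := sysL.
have [iLK _ _] := insert_arc_system j1 jm sysL.
have Kj0 : K j != j by apply: Kfix; lia.
have Kj1 : K j.+1 != j.+1 by apply: Kfix; lia.
have Kj2 : K j.+1 != j by apply: contraNneq Kj => Kj1E; rewrite -{1}Kj1E KK.
(* The retraction pushes each of the two points to be removed along [K] to a surviving point. *)
pose nb x := if x == j then K j else if x == j.+1 then K j.+1 else x.
have nbj x : nb x != j.
  by rewrite /nb; case: (eqVneq x j) => // xj; case: (eqVneq x j.+1).
have nbj1 x : nb x != j.+1.
  by rewrite /nb; case: (eqVneq x j) => // xj; case: (eqVneq x j.+1).
have nbm (x : 'I_m.+2.+2) : nb x < m.+2.+2.
  by rewrite /nb; case: eqP => _; [|case: eqP => _; [|exact: ltn_ord]]; apply: Km; lia.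
pose r (x : 'I_m.+2.+2) : 'I_m.+2 := inord (unskip j (nb x)).
have rE x : r x = unskip j (nb x) :> nat.
  by rewrite inordK // -(skip_bound _ jm) skip_unskip.
have hrE x : h (r x) = nb x :> nat by rewrite hE rE skip_unskip.
have nbs z : nb (skip j z) = skip j z by rewrite /nb !skip_neq.
have nb_fst : nb j = K j by rewrite /nb eqxx.
have nb_snd : nb j.+1 = K j.+1 by rewrite /nb eqxx; case: eqP => //; lia.
have hK : cancel h r by move=> x; apply: val_inj; rewrite /= rE hE nbs skipK.
have e_sym := arcs_sym (m := m.+2) iLK KK.
have e'_sym := arcs_sym (m := m) LK CK.
have stepK (x y : 'I_m.+2.+2) : y = K x :> nat ->
    connect (@arcs m.+2 (insert_arc j L) K) x y.
  by move=> yx; apply: connect1; rewrite /arcs yx eqxx orbT.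
have stepL (x y : 'I_m.+2.+2) : y = insert_arc j L x :> nat ->
    connect (@arcs m.+2 (insert_arc j L) K) x y.
  by move=> yx; apply: connect1; rewrite /arcs yx eqxx.
have stepC (x y : 'I_m.+2) : y = contract_arc j K x :> nat ->
    connect (@arcs m L (contract_arc j K)) x y.
  by move=> yx; apply: connect1; rewrite /arcs yx eqxx orbT.
have stepL' (x y : 'I_m.+2) : y = L x :> nat ->
    connect (@arcs m L (contract_arc j K)) x y.
  by move=> yx; apply: connect1; rewrite /arcs yx eqxx.
have ltj : j < m.+4 by lia.
have ltj1 : j.+1 < m.+4 by lia.
pose oj : 'I_m.+2.+2 := Ordinal ltj; pose oj1 : 'I_m.+2.+2 := Ordinal ltj1.
have ojj : connect (@arcs m.+2 (insert_arc j L) K) oj oj1.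
  by apply: stepL; rewrite /= insertE.
have h_step x y : @arcs m L (contract_arc j K) x y ->
    connect (@arcs m.+2 (insert_arc j L) K) (h x) (h y).
  case/orP => /eqP; first by move=> yx; apply: stepL; rewrite !hE insertE yx.
  rewrite /contract_arc; case: eqP => [Kx|/eqP nj] yx.
    apply: (@connect_trans _ _ oj); first by apply: stepK; rewrite hE Kx.
    apply: connect_trans ojj _; apply: stepK; rewrite hE yx skip_unskip //=.
  case: eqP yx => [Kx|/eqP nj1] yx.
    apply: (@connect_trans _ _ oj1); first by apply: stepK; rewrite hE Kx.
    rewrite (sym_connect_sym e_sym); apply: (@connect_trans _ _ oj); last exact: ojj.
    rewrite (sym_connect_sym e_sym); apply: stepK; rewrite hE yx skip_unskip //=.
  by apply: stepK; rewrite !hE yx skip_unskip.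
have r_step (x y : 'I_m.+2.+2) : x \in predT -> @arcs m.+2 (insert_arc j L) K x y ->
    connect (@arcs m L (contract_arc j K)) (r x) (r y).
  move=> _ /orP[] /eqP yx.
    move: yx; case: (skipP j x) (rE x) => [||z] rx; rewrite insertE => yx.
    - apply: stepC; rewrite rx rE yx /contract_arc skip_unskip ?nbj //.
      by rewrite nb_fst nb_snd KK eqxx.
    - apply: stepC; rewrite rx rE yx /contract_arc skip_unskip ?nbj //.
      by rewrite nb_fst nb_snd KK eqxx; case: eqP => //; lia.
    - by apply: stepL'; rewrite rx rE yx !nbs !skipK.
  (* An edge of [K] that meets the removed pair is collapsed to a point; any other is left as it
     is. *)
  have [nbyx|[nbx nby]] : nb x = nb y \/ nb x = x /\ nb y = y.
    rewrite /nb yx; case: (eqVneq (x : nat) j) => [->|xj].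
      by left; rewrite (negPf Kj0) (negPf Kj).
    case: (eqVneq (x : nat) j.+1) => [->|xj1].
      by left; rewrite (negPf Kj1) (negPf Kj2).
    case: eqP => [Kxj|_]; first by left; rewrite -[LHS]KK Kxj.
    by case: eqP => [Kxj|_]; [left; rewrite -[LHS]KK Kxj|right].
  - have -> : r x = r y by apply: val_inj; rewrite /= !rE nbyx.
    exact: connect0.
  apply: stepC; rewrite !rE /contract_arc skip_unskip // nbx -yx nby.
  by have := nbj y; have := nbj1 y; rewrite nby => /negPf-> /negPf->.
have unit_r (x : 'I_m.+2.+2) : x \in predT ->
    connect (@arcs m.+2 (insert_arc j L) K) x (h (r x)).
  move=> _; case: (eqVneq (x : nat) j) => [xj|xj].
    by apply: stepK; rewrite hrE xj nb_fst.
  case: (eqVneq (x : nat) j.+1) => [xj1|xj1].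
    by apply: stepK; rewrite hrE xj1 nb_snd.
  have -> : h (r x) = x; last exact: connect0.
  by apply: val_inj; rewrite /= hrE /nb (negPf xj) (negPf xj1).
have cl_predT : fingraph.closed (@arcs m.+2 (insert_arc j L) K) predT by [].
have conn := connect_retract cl_predT (fun _ => isT) h_step r_step hK.
split; last by rewrite /through conn h0 h1.
rewrite /loops -(n_comp_retract e_sym e'_sym cl_predT (fun _ => isT) h_step
  r_step hK unit_r (P := [predC outer (insert_arc j L) K])
  (P' := [predC outer L (contract_arc j K)])).
- by apply: eq_n_comp_r => x; rewrite !inE.
- exact: outer_closed iLK KK.
- by move=> x; congr negb; rewrite /in_mem /= /outer !conn h0 h1.
Qed.

(** The two inserted arcs face each other, so [j] and [j.+1] form a component of their own, away
    from the outer points. Off this component the picture is the old one renumbered. *)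
Lemma loops_insert K : arc_system m K ->
  loops m.+2 (insert_arc j L) (insert_arc j K) = (loops m L K).+1 /\
  through m.+2 (insert_arc j L) (insert_arc j K) = through m L K.
Proof.
move=> sysK; have [LK Lm _] := sysL; have [KK Km _] := sysK.
have [iLK iLm _] := insert_arc_system j1 jm sysL.
have [iKK _ _] := insert_arc_system j1 jm sysK.
have e_sym := arcs_sym (m := m.+2) iLK iKK.
have e'_sym := arcs_sym (m := m) LK KK.
set e := @arcs m.+2 _ _ in e_sym *; set e' := @arcs m _ _ in e'_sym *.
pose a : {pred 'I_m.+2.+2} := [pred x : 'I_m.+2.+2 | (nat_of_ord x != j) && (nat_of_ord x != j.+1)].
pose r (x : 'I_m.+2.+2) : 'I_m.+2 := inord (unskip j x).
have rh x : h (r x) = x \/ x \notin a.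
  have [/andP[xj xj1]|] := boolP (x \in a); [left|by right].
  apply: val_inj; rewrite /= hE inordK ?skip_unskip //.
  by rewrite -(skip_bound _ jm) skip_unskip.
have h_a x : h x \in a by rewrite inE !hE !skip_neq.
have hr x : x \in a -> exists2 z, x = h z & r x = z.
  by have [rx _|/negPf->//] := rh x; exists (r x).
have ins_a M (x y : 'I_m.+2.+2) : y = insert_arc j M x :> nat -> (x \in a) = (y \in a).
  rewrite !inE => ->; case: (skipP j x) => [||z]; rewrite !insertE ?eqxx ?andbF //.
  by rewrite !skip_neq.
have cl_a : fingraph.closed e a by move=> x y /orP[]/eqP/ins_a.
have hK : cancel h r by move=> x; apply: val_inj; rewrite /= inordK hE skipK.
have h_step x y : e' x y -> connect e (h x) (h y).
  by move=> xy; apply: connect1; rewrite /e /arcs !hE !insertE !skip_eq.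
have r_step x y : x \in a -> e x y -> connect e' (r x) (r y).
  move=> xa xy; have ya : y \in a by rewrite -(cl_a _ _ xy).
  have [z xz ->] := hr _ xa; have [t yt ->] := hr _ ya; apply: connect1.
  by move: xy; rewrite xz yt /e /arcs !hE !insertE !skip_eq.
have unit_r x : x \in a -> connect e x (h (r x)).
  by move=> /hr[z -> ->]; exact: connect0.
have conn := connect_retract cl_a h_a h_step r_step hK.
split; last by rewrite /through conn h0 h1.
have outer_a x : outer (insert_arc j L) (insert_arc j K) x -> x \in a.
  by case/orP => /(closed_connect cl_a) ->; rewrite -?h0 -?h1 h_a.
have ltj : j < m.+4 by lia.
pose oj : 'I_m.+2.+2 := Ordinal ltj.
rewrite /loops -/e -/e' -(n_comp_retract e_sym e'_sym cl_a h_a h_step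
  r_step hK unit_r (P := [predC outer (insert_arc j L) (insert_arc j K)])
  (P' := [predC outer L K])).
- rewrite -[RHS]addn1 -(n_comp_connect (sym_connect_sym e_sym) oj).
  rewrite /n_comp_mem -(cardID a); congr addn; apply: eq_card => x.
    by rewrite /in_mem /= /in_mem /= -andbA; congr andb; exact: andbC.
  rewrite /in_mem /= /in_mem /=.
  case ax: (a x) => /=.
    apply/esym/negbTE; rewrite negb_and orbC; apply/orP; left.
    apply/negP => /(closed_connect cl_a); rewrite [RHS]ax.
    by rewrite inE /= eqxx.
  congr andb; transitivity true.
    by apply/negP => /outer_a; rewrite /in_mem /= ax.
  apply/esym; have : nat_of_ord x = j \/ nat_of_ord x = j.+1.
    by move/negbT: ax; rewrite /= negb_and !negbK => /orP[]/eqP; [left|right].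
  case=> xj; first by rewrite (_ : x = oj) ?connect0 //; apply: val_inj.
  by apply: connect1; rewrite /e /arcs /= xj insertE eqxx.
- exact: outer_closed iLK iKK.
- by move=> x; congr negb; rewrite /in_mem /= /outer !conn h0 h1.
Qed.

End Insertion.

(** * Words of insertions and their cancellation *)

Definition add2 (w : seq nat) (m : nat) := iter (size w) (fun k => k.+2) m.

Definition insert_word (w : seq nat) (K : nat -> nat) := foldr insert_arc K w.

(* A word lists the positions of insertions, the last one first. The bounds are
   those for a diagram with at least one top point. *)
Fixpoint word_ok (w : seq nat) : bool :=
  if w is l :: v then (1 < l <= (size v).*2.+3) && word_ok v else true.

(* Contracts j and j + 1 in the diagram of a word: either the contraction closes
   a loop or it cancels one of the insertions. The result is [None] when it would
   involve a point of the underlying diagram. *)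
Fixpoint cap (j : nat) (w : seq nat) : option (bool * seq nat) :=
  if w is l :: v then
    if j == l then Some (true, v)
    else if (j.+1 == l) || (j == l.+1) then
      if minn j l <= (size v).*2.+2 then Some (false, v) else None
    else if j < l then omap (fun p => (p.1, l - 2 :: p.2)) (cap j v)
    else if j <= (size v).*2.+3 then
      omap (fun p => (p.1, l :: p.2)) (cap (j - 2) v)
    else None
  else None.

(** The last insertion of [w1] crosses the inner product and becomes a contraction of [w2]. A value
    is returned only if all insertions on both sides cancel. *)
Fixpoint pairing_loops (w1 w2 : seq nat) : option nat :=
  if w1 is j :: v1 then
    if cap j w2 is Some (b, v2) then omap (addn b) (pairing_loops v1 v2) else None
  else if w2 is [::] then Some 0 else None.

Lemma add2E w m : add2 w m = (size w).*2 + m.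
Proof. by rewrite /add2; elim: (size w) => //= n ->. Qed.

Section Words.
Variables (m : nat).
Hypothesis m_gt0 : 0 < m.

Lemma insert_word_system w K : word_ok w -> arc_system m K ->
  arc_system (add2 w m) (insert_word w K).
Proof.
move=> + sysK; elim: w => //= l v IH /andP[/andP[l1 lv] /IH]; apply: insert_arc_system => //.
rewrite add2E; lia.
Qed.

(** The contraction moves past the insertions disjoint from it until it meets either the same arc,
    which closes a loop, or an adjacent one, which is straightened by a zigzag. *)
Lemma capP j w b v K : 1 < j -> word_ok w -> arc_system m K ->
  cap j w = Some (b, v) ->
  [/\ word_ok v, size w = (size v).+1 &
    if b then insert_word w K = insert_arc j (insert_word v K)
    else insert_word w K j != j.+1 /\ contract_arc j (insert_word w K) = insert_word v K].
Proof.
move=> + + sysK; elim: w j b v => //= l w IH j b v j1 /andP[/andP[l1 lw] wok].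
have [KK Km Kfix] := insert_word_system wok sysK.
(* This is where [m_gt0] enters: [(size w).*2.+2] is the last point certain to exist for every
   positive [m], whence the bounds in [cap] and [word_ok]. *)
have fix_lt x : 1 < x -> x <= (size w).*2.+2 -> insert_word w K x != x.
  by move=> x1 xw; apply: Kfix; rewrite x1 add2E; lia.
case: eqP => [-> [<- <-]//|/eqP nlj].
case: ifP => [adj|nadj].
  case: ifP => // small [<- <-]; split=> //.
  case/orP: adj => /eqP jl.
    subst l; rewrite contract_insert_succ; last by apply: fix_lt; lia.
    split=> //; have := insert_skip j.+1 (insert_word w K) j; rewrite skip_lt // => ->.
    by apply/eqP; rewrite /skip; ifs.
  subst j; rewrite contract_insert_pred; last by apply: fix_lt; lia.
  by split=> //; rewrite insert_snd; apply/eqP; lia.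
case: ltnP => [jl|lj].
  have [l' ll jl'] : exists2 l', l = l'.+2 & j <= l' by exists (l - 2); lia.
  case E: (cap j w) => [[c u]|] //= [<- <-].
  have [uok sw H] := IH _ _ _ j1 wok E.
  have -> : l - 2 = l' by lia.
  split=> /=; [rewrite uok andbT; lia|exact: congr1|subst l].
  case: c H {E} => [->|[Xj <-]]; first by rewrite -insert_insert.
  rewrite contract_insert_gt ?jl' ?andbT; last by lia.
  split=> //; have := insert_skip l'.+2 (insert_word w K) j.
  rewrite skip_lt // => ->; apply: contraNneq Xj => e.
  by rewrite -(skip_eq l'.+2) e skip_lt //; lia.
case: leqP => // jw.
have [j' jj lj'] : exists2 j', j = j'.+2 & l <= j' by exists (j - 2); lia.
case E: (cap (j - 2) w) => [[c u]|] //= [<- <-].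
have j2 : 1 < j - 2 by lia.
have [uok sw H] := IH _ _ _ j2 wok E.
have jE : j - 2 = j' by lia.
rewrite jE in H; split=> /=; [rewrite uok andbT; lia|exact: congr1|subst j].
case: c H {E} => [->|[Xj <-]]; first by rewrite insert_insert.
rewrite contract_insert_lt //; first last.
- by apply: fix_lt; lia.
- by apply: fix_lt; lia.
- exact: can_inj KK.
split=> //; have := insert_skip l (insert_word w K) j'.
rewrite skip_ge // => ->; apply: contraNneq Xj => e.
by rewrite -(skip_eq l) e skip_ge //; lia.
Qed.

(** The offset [k] depends on the words alone, while [L] and [K] are arbitrary; this is what turns a
    local computation into a scalar factor. *)
Lemma pairing_loopsP w1 w2 k L K : word_ok w1 -> word_ok w2 ->
    arc_system m L -> arc_system m K -> pairing_loops w1 w2 = Some k ->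
  [/\ size w1 = size w2,
    loops (add2 w1 m) (insert_word w1 L) (insert_word w2 K) = k + loops m L K &
    through (add2 w1 m) (insert_word w1 L) (insert_word w2 K) = through m L K].
Proof.
move=> + + sysL sysK; elim: w1 w2 k => [|j v1 IH] w2 k /=; first by case: w2 => // _ _ [<-].
move=> /andP[/andP[j1 jv] ok1] ok2; case E: (cap j w2) => [[b v2]|] //.
case E': (pairing_loops v1 v2) => [n|] //= [<-].
have [okv2 sw2 H] := capP j1 ok2 sysK E.
have [sv IHl IHt] := IH _ _ ok1 okv2 E'.
have sys1 := insert_word_system ok1 sysL.
have sysv := insert_word_system okv2 sysK.
have sys2 := insert_word_system ok2 sysK.
have add2v : add2 v2 m = add2 v1 m by rewrite !add2E sv.
have add2w : add2 w2 m = (add2 v1 m).+2 by rewrite !add2E sw2 sv.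
rewrite add2v in sysv; rewrite add2w in sys2.
have jm : j <= (add2 v1 m).+2 by rewrite add2E; lia.
(* The two sizes are convertible because [add2] iterates [.+2] along the word. *)
rewrite sw2 sv -[add2 (j :: v1) m]/(add2 v1 m).+2; case: b H {E} => [wE|[wj wE]].
  by rewrite wE; have [-> ->] := loops_insert j1 jm sys1 sysv; rewrite IHl IHt.
have [|-> ->] := loops_contract j1 jm sys1 sys2 wj; first by rewrite wE.
by rewrite wE IHl IHt.
Qed.
End Words.

(** * Diagrams *)

Section DiagramTheory.
Variables m n : nat.
Implicit Type d : diagram m n.

Lemma pairing_neq d u : d u != u.
Proof. by case: d => d /= /and3P[/forallP]. Qed.

Lemma pairingK d : involutive d.
Proof. by case: d => d /= /and3P[_ /forallP H _] u; apply/eqP. Qed.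

Lemma pairing_noncrossing d u v :
  bpos u < bpos v -> bpos v < bpos (d u) -> bpos (d u) < bpos (d v) -> False.
Proof.
case: d => d /= /and3P[_ _ /negP H] uv vu dd; apply: H.
by apply/existsP; exists u; apply/existsP; exists v; rewrite uv vu.
Qed.

Lemma diagramP d (e : diagram m n) : (forall u, d u = e u) -> d = e.
Proof. by move=> de; apply/val_inj/ffunP. Qed.

Lemma diagram_ex (f : boundary m n -> boundary m n) :
  (forall u, f u != u) -> involutive f ->
  (forall u v, bpos u < bpos v -> bpos v < bpos (f u) ->
     bpos (f u) < bpos (f v) -> False) ->
  exists d : diagram m n, forall u, d u = f u.
Proof.
move=> f_neq fK f_nc.
have nc : noncrossing_pairing [ffun u => f u].
  apply/and3P; split; first by apply/forallP => u; rewrite ffunE.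
    by apply/forallP => u; rewrite !ffunE fK.
  apply/negP => /existsP[u /existsP[v]]; rewrite !ffunE => /and3P[].
  exact: f_nc.
by exists (Diagram nc) => u; rewrite /= ffunE.
Qed.

Lemma bpos_inj : injective (@bpos m n).
Proof.
move=> [i|i] [j|j] /= ij; try (congr inl; exact: val_inj);
  try (have := ltn_ord i; have := ltn_ord j; lia).
by congr inr; apply: val_inj => /=; have := ltn_ord i; have := ltn_ord j; lia.
Qed.

End DiagramTheory.

Lemma flip_ex m n (d : diagram m n) : exists e : diagram n m, is_flip d e.
Proof.
have swapK (p q : nat) : cancel (@swap_sum 'I_p 'I_q) (@swap_sum 'I_q 'I_p) by case.
have bpos_swap (u : boundary m n) : bpos (swap_sum u) = m + n - 1 - bpos u.
  by case: u => i /=; have := ltn_ord i; lia.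
have bpos_lt (u : boundary m n) : bpos u < m + n.
  by case: u => i /=; have := ltn_ord i; lia.
have [||u v|e eE] := @diagram_ex n m (fun u => swap_sum (d (swap_sum u))).
- move=> u; apply/eqP => /(congr1 (@swap_sum _ _)); rewrite swapK => /eqP.
  by rewrite (negPf (pairing_neq _ _)).
- by move=> u; rewrite swapK pairingK swapK.
- rewrite -(swapK _ _ u) -(swapK _ _ v); move: (swap_sum u) (swap_sum v) => {}u {}v.
  rewrite !swapK !bpos_swap => uv vu dd.
  (* The reflection reverses the boundary order, so a crossing of the image read from [u] is a
     crossing of [d] read from [d v]. *)
  have := @pairing_noncrossing _ _ d (d v) (d u); rewrite !pairingK.
  have := bpos_lt u; have := bpos_lt v; have := bpos_lt (d u); have := bpos_lt (d v).
  by move=> *; lia.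
by exists e; apply/forallP => u; rewrite eE swapK.
Qed.

Lemma id_ex n : exists d : diagram n n, is_id d.
Proof.
have [||u v|d dE] := @diagram_ex n n (@swap_sum 'I_n 'I_n).
- by case.
- by case.
- by case: u => i; case: v => j /=; have := ltn_ord i; have := ltn_ord j; lia.
by exists d; apply/forallP => i; rewrite dE.
Qed.

Lemma cup_ex : exists d : diagram 0 2, d (inr ord0) == inr ord_max.
Proof.
have [||u v|d dE] := @diagram_ex 0 2 (fun u => if u is inr i then inr (rev_ord i) else u).
- by case=> [[]//|i]; apply/eqP => -[/(congr1 val)]; case: i => [[|[|]]].
- by case=> [[]//|i]; rewrite rev_ordK.
- by case: u => [[]//|i]; case: v => [[]//|j]; case: i => [[|[|]]] // ?; case: j => [[|[|]]].
by exists d; rewrite dE; apply/eqP; congr inr; apply: val_inj.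
Qed.

Section Hcat.
Variables (m n m' n' : nat).

Variant hcat_spec : boundary (m + m') (n + n') -> Type :=
| HcatL u : hcat_spec (hcat_l m' n' u)
| HcatR u : hcat_spec (hcat_r m n u).

Lemma hcatP w : hcat_spec w.
Proof.
case: w => i; rewrite -(fintype.splitK i); case: (fintype.split i) => k.
- exact: (HcatL (inl k)).
- exact: (HcatR (inl k)).
- exact: (HcatL (inr k)).
- exact: (HcatR (inr k)).
Qed.

(** Counterclockwise, the points of the right factor form one interval between the bottom and the
    top points of the left factor; hence no crossing arises between the two. *)
Lemma bpos_hcat_l (u : boundary m n) : bpos (hcat_l m' n' u) =
  if bpos u < m then bpos u else bpos u + m' + n'.
Proof. by case: u => i /=; have ? := ltn_ord i; case: ifP; lia. Qed.

Lemma bpos_hcat_r (u : boundary m' n') : bpos (hcat_r m n u) = m + bpos u.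
Proof. by case: u => i /=; have := ltn_ord i; lia. Qed.

Lemma hcat_ex (d : diagram m n) (e : diagram m' n') :
  exists c : diagram (m + m') (n + n'), is_hcat d e c.
Proof.
pose f (w : boundary (m + m') (n + n')) : boundary (m + m') (n + n') :=
  match w with
  | inl i => match fintype.split i with
    | inl k => hcat_l m' n' (d (inl k)) | inr k => hcat_r m n (e (inl k)) end
  | inr i => match fintype.split i with
    | inl k => hcat_l m' n' (d (inr k)) | inr k => hcat_r m n (e (inr k)) end
  end.
have fl u : f (hcat_l m' n' u) = hcat_l m' n' (d u).
  by case: u => k /=; rewrite -[lshift _ k]/(unsplit (inl k)) fintype.unsplitK.
have fr u : f (hcat_r m n u) = hcat_r m n (e u).
  by case: u => k /=; rewrite -[rshift _ k]/(unsplit (inr k)) fintype.unsplitK.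
have lt_r (u : boundary m' n') : bpos u < m' + n'.
  by case: u => i /=; have := ltn_ord i; lia.
have [||u v|c cE] := @diagram_ex _ _ f.
- move=> w; case: (hcatP w) => u; rewrite ?fl ?fr.
    apply/eqP => /(congr1 (@bpos _ _)); rewrite !bpos_hcat_l => H.
    have /eqP := pairing_neq d u; apply; apply: bpos_inj; move: H; do 2 case: ifP; lia.
  apply/eqP => /(congr1 (@bpos _ _)); rewrite !bpos_hcat_r => /addnI/bpos_inj/eqP.
  by rewrite (negPf (pairing_neq _ _)).
- by move=> w; case: (hcatP w) => u; rewrite ?fl ?fr ?fl ?fr pairingK.
- case: (hcatP u) => {}u; case: (hcatP v) => {}v; rewrite ?fl ?fr ?bpos_hcat_l ?bpos_hcat_r.
  + move=> uv vu dd; apply: (@pairing_noncrossing _ _ d u v); move: uv vu dd; ifs.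
  + have := lt_r v; have := lt_r (e v); ifs.
  + have := lt_r u; have := lt_r (e u); ifs.
  + move=> *; apply: (@pairing_noncrossing _ _ e u v); lia.
exists c; apply/andP; split; apply/forallP => u; rewrite cE ?fl ?fr //.
Qed.
End Hcat.

(* The diagram of the identity with a cup inserted at the top points j, j + 1. *)
Definition inserter j m n (c : diagram m n) : Prop :=
  (forall k, exists2 k', c (inl k) = inr k' & k' = skip j k :> nat) /\
  (forall k k' : 'I_n, k = j :> nat -> k' = j.+1 :> nat -> c (inr k) = inr k').

Lemma inserter_cup (c : diagram 0 2) : c (inr ord0) == inr ord_max -> inserter 0 c.
Proof.
move=> /eqP cE; split=> [[]//|k k' k0 k1].
by rewrite (_ : k = ord0) ?cE; [congr inr|]; apply: val_inj.
Qed.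

Lemma inserter_hcat_id j m n k (d : diagram k k) (e : diagram m n) c :
  is_id d -> inserter j e -> is_hcat d e c -> inserter (k + j) c.
Proof.
move=> /forallP idd [e1 e2] /andP[/forallP cl /forallP cr]; split=> [i|i i'].
  rewrite -(fintype.splitK i); case: (fintype.split i) => t /=.
    exists (lshift n t); first by have /eqP := cl (inl t); rewrite /= (eqP (idd t)).
    by rewrite /= skip_lt //; have := ltn_ord t; lia.
  have [t' et tj] := e1 t; exists (rshift k t'); last by rewrite /= tj /skip; ifs.
  by have /eqP := cr (inl t); rewrite /= et.
rewrite -(fintype.splitK i) -(fintype.splitK i').
case: (fintype.split i) => t /=; case: (fintype.split i') => t' /=;
  have := ltn_ord t; have := ltn_ord t'; try lia.
move=> _ _ tj tj'; have /eqP := cr (inr t); rewrite /= => ->.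
by rewrite (e2 t t') //; lia.
Qed.

Lemma inserter_hcat j m n k (d : diagram k k) (e : diagram m n) c :
  is_id d -> j <= m -> n = m.+2 -> inserter j e -> is_hcat e d c -> inserter j c.
Proof.
move=> /forallP idd jm nm [e1 e2] /andP[/forallP cl /forallP cr]; split=> [i|i i'].
  rewrite -(fintype.splitK i); case: (fintype.split i) => t /=.
    have [t' et tj] := e1 t; exists (lshift k t'); last by rewrite /= tj.
    by have /eqP := cl (inl t); rewrite /= et.
  exists (rshift n t); first by have /eqP := cr (inl t); rewrite /= (eqP (idd t)).
  by rewrite /= skip_ge; lia.
rewrite -(fintype.splitK i) -(fintype.splitK i').
case: (fintype.split i) => t /=; case: (fintype.split i') => t' /=;
  have := ltn_ord t; have := ltn_ord t'; try lia.
move=> _ _ tj tj'; have /eqP := cl (inr t); rewrite /= => ->.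
by rewrite (e2 t t').
Qed.

(** * From glued diagrams to arcs on numbered points *)

Definition code (b : bool) n (u : boundary 1 n) : nat :=
  if u is inr k then k.+2 else b.

Lemma code_inj b n : injective (@code b n).
Proof.
case=> i [] j /=; try (case: b; lia); first by rewrite (ord1 i) (ord1 j).
by case=> ij; congr inr; apply: val_inj.
Qed.

(* [b] codes the bottom point: the two diagrams of an inner product get different
   outer points. *)
Definition arcs_of b n (d : diagram 1 n) (x : nat) : nat :=
  if [pick u | code b u == x] is Some u then code b (d u) else x.

Section ArcsOf.
Variables (b : bool) (n : nat) (d : diagram 1 n).

Lemma arcs_ofE u : arcs_of b d (code b u) = code b (d u).
Proof.
by rewrite /arcs_of; case: pickP => [v /eqP/code_inj-> //|/(_ u)]; rewrite eqxx.
Qed.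

Lemma arcs_of_out x : (forall u : boundary 1 n, code b u != x) -> arcs_of b d x = x.
Proof. by rewrite /arcs_of => H; case: pickP => // u; rewrite (negPf (H u)). Qed.

Variant code_spec : nat -> Type :=
| CodeIn (u : boundary 1 n) : code_spec (code b u)
| CodeOut x of (forall u : boundary 1 n, code b u != x) : code_spec x.

Lemma codeP x : code_spec x.
Proof.
have [|H] := pickP (fun u : boundary 1 n => code b u == x).
  by move=> u /eqP <-; exact: CodeIn.
by apply: CodeOut => u; rewrite H.
Qed.

Lemma code_lt (u : boundary 1 n) : code b u < n.+2.
Proof. by case: u => [i|i] /=; [case: b|have := ltn_ord i; lia]. Qed.

Lemma arcs_of_system : arc_system n (arcs_of b d).
Proof.
split=> [x|x|x].
- by case: (codeP x) => [u|{}x ux]; rewrite ?arcs_ofE ?pairingK // !arcs_of_out.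
- by case: (codeP x) => [u|{}x ux]; rewrite ?arcs_ofE ?code_lt // arcs_of_out.
move=> /andP[x1 xn]; have ltx : x - 2 < n by lia.
have -> : x = code b (inr (Ordinal ltx) : boundary 1 n) by rewrite /=; lia.
by rewrite arcs_ofE (inj_eq (@code_inj _ _)) pairing_neq.
Qed.
End ArcsOf.

Lemma is_composite_unique m n p (e : diagram n p) (d : diagram m n) (c c' : diagram m p) :
  is_composite e d c -> is_composite e d c' -> c = c'.
Proof.
move=> /forallP cP /forallP cP'; apply: diagramP => u.
apply/eqP; rewrite (eqP (forallP (cP u) _)).
by rewrite -(eqP (forallP (cP' u) _)).
Qed.

Lemma glue_rel_sym m n p (e : diagram n p) (d : diagram m n) : symmetric (glue_rel e d).
Proof.
suff H x y : glue_rel e d x y -> glue_rel e d y x by move=> x y; apply/idP/idP; apply: H.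
case/orP => /existsP[u /andP[/eqP-> /eqP->]]; apply/orP; [left|right].
  by apply/existsP; exists (d u); rewrite pairingK !eqxx.
by apply/existsP; exists (e u); rewrite pairingK !eqxx.
Qed.

Lemma glue_lower_step m n p (e : diagram n p) (d : diagram m n) u :
  glue_rel e d (glue_lower p u) (glue_lower p (d u)).
Proof. by apply/orP; left; apply/existsP; exists u; rewrite !eqxx. Qed.

Lemma glue_upper_step m n p (e : diagram n p) (d : diagram m n) u :
  glue_rel e d (glue_upper m u) (glue_upper m (e u)).
Proof. by apply/orP; right; apply/existsP; exists u; rewrite !eqxx. Qed.

Section InsertCup.
Variables (n j : nat).
Hypothesis jn : j <= n.

Let lift_pt (u : boundary 1 n) : boundary 1 n.+2 :=
  match u with inl i => inl i | inr k => inr (inord (skip j k)) end.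
Let cup_l : boundary 1 n.+2 := inr (inord j).
Let cup_r : boundary 1 n.+2 := inr (inord j.+1).

Let code_lift b u : code b (lift_pt u) = skip j.+2 (code b u).
Proof.
case: u => [i|k] /=; first by rewrite skip_lt //; case: b.
by rewrite inordK ?skip_bound ?ltn_ord // /skip; ifs.
Qed.
Let code_cup_l b : code b cup_l = j.+2.
Proof. by rewrite /= inordK //; lia. Qed.
Let code_cup_r b : code b cup_r = j.+3.
Proof. by rewrite /= inordK //; lia. Qed.

Variant cup_spec : boundary 1 n.+2 -> Prop :=
| CupL : cup_spec cup_l | CupR : cup_spec cup_r
| CupLift u : cup_spec (lift_pt u).

Let cupP w : cup_spec w.
Proof.
case: w => [i|k]; first exact: (CupLift (inl i)).
have [x xk] : exists x, nat_of_ord k = x by exists k.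
case: (skipP j x) xk => [||z] kE.
- have -> : inr k = cup_l; last exact: CupL.
  by apply: (@code_inj true); rewrite code_cup_l /= kE.
- have -> : inr k = cup_r; last exact: CupR.
  by apply: (@code_inj true); rewrite code_cup_r /= kE.
have zn : z < n by have := ltn_ord k; rewrite kE skip_bound.
have -> : inr k = lift_pt (inr (Ordinal zn)); last exact: CupLift.
apply: (@code_inj true); rewrite code_lift /= kE /skip; ifs.
Qed.

Let bpos_lift u : bpos (lift_pt u) = if n - j < bpos u then (bpos u).+2 else bpos u.
Proof.
case: u => [i|k] /=; first by rewrite (ord1 i).
by have ? := ltn_ord k; rewrite inordK ?skip_bound // /skip; ifs.
Qed.
Let bpos_cup_l : bpos cup_l = n.+2 - j.
Proof. by rewrite /= inordK; lia. Qed.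
Let bpos_cup_r : bpos cup_r = n.+1 - j.
Proof. by rewrite /= inordK; lia. Qed.

(** The cup occupies two consecutive boundary positions and [lift_pt] preserves the boundary order,
    so no crossing is created. *)
Lemma insert_cup_ex (d : diagram 1 n) : exists d' : diagram 1 n.+2,
  [/\ d' cup_l = cup_r, d' cup_r = cup_l & forall u, d' (lift_pt u) = lift_pt (d u)].
Proof.
pose f (w : boundary 1 n.+2) : boundary 1 n.+2 :=
  if w == cup_l then cup_r else if w == cup_r then cup_l else
  if [pick u | lift_pt u == w] is Some u then lift_pt (d u) else w.
have lr : cup_r == cup_l = false.
  by apply/eqP => /(congr1 (@code true _)); rewrite code_cup_l code_cup_r; lia.
have ll u : lift_pt u == cup_l = false.
  apply/eqP => /(congr1 (@code true _)); rewrite code_cup_l code_lift => /eqP.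
  by rewrite skip_neq.
have rl u : lift_pt u == cup_r = false.
  apply/eqP => /(congr1 (@code true _)); rewrite code_cup_r code_lift => /eqP.
  by rewrite skip_neq.
have lift_inj : injective lift_pt.
  move=> u v /(congr1 (@code true _)); rewrite !code_lift => /eqP.
  by rewrite skip_eq => /eqP/code_inj.
have fl : f cup_l = cup_r by rewrite /f eqxx.
have fr : f cup_r = cup_l by rewrite /f lr eqxx.
have fu u : f (lift_pt u) = lift_pt (d u).
  by rewrite /f ll rl; case: pickP => [v /eqP/lift_inj->//|/(_ u)]; rewrite eqxx.
have [||u v|d' dE] := @diagram_ex _ _ f.
- by move=> w; case: (cupP w) => [||u];
    rewrite ?fl ?fr ?fu ?(inj_eq lift_inj) ?pairing_neq ?lr // eq_sym lr.
- by move=> w; case: (cupP w) => [||u]; rewrite ?fl ?fr ?fu ?fl ?fr ?fu ?pairingK.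
- case: (cupP u) => [||{}u]; case: (cupP v) => [||{}v];
    rewrite ?fl ?fr ?fu ?bpos_lift ?bpos_cup_l ?bpos_cup_r; try (by ifs).
  move=> uv vu dd; apply: (@pairing_noncrossing _ _ d u v); move: uv vu dd; ifs.
by exists d'; rewrite !dE; split=> // u; rewrite dE.
Qed.

Variables (c : diagram n n.+2) (d : diagram 1 n).
Hypothesis c_ins : inserter j c.

Lemma insert_cup_composite : exists d' : diagram 1 n.+2,
  [/\ is_composite c d d', nloops c d = 0 &
      forall b, arcs_of b d' = insert_arc j.+2 (arcs_of b d)].
Proof.
have [d' [dl dr du]] := insert_cup_ex d; exists d'.
have [c1 c2] := c_ins.
have c_cup : c (inr (inord j)) = inr (inord j.+1).
  by apply: c2; rewrite inordK //; lia.
have c_lift k : c (inl k) = inr (inord (skip j k)).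
  have [k' -> k'E] := c1 k; congr inr.
  by rewrite -k'E inord_val.
have c_cup' : c (inr (inord j.+1)) = inr (inord j) by rewrite -c_cup pairingK.
have c_lift' (k : 'I_n) : c (inr (inord (skip j k))) = inl k by rewrite -c_lift pairingK.
(* Slides a point along the straight strands of [c] to the outer boundary. Every point is connected
   to its representative, so there are no loops, and an edge either keeps the representative or
   applies [d'] to it. *)
pose rep (x : glued 1 n n.+2) : boundary 1 n.+2 :=
  match x with inl u => lift_pt u | inr k => inr k end.
have rep_outer u : rep (glue_outer n u) = u by case: u.
have rep_step x y : glue_rel c d x y -> rep y = rep x \/ rep y = d' (rep x).
  case/orP => /existsP[u /andP[/eqP-> /eqP->]]; first by right; rewrite /= du.
  case: u => [k|k]; first by left; rewrite c_lift.
  have := cupP (inr k); move E : (inr k) => w wP.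
  case: wP E => [[->]|[->]|[//|z] [->]].
  - by right; rewrite c_cup /=; apply/esym; exact: dl.
  - by right; rewrite c_cup' /=; apply/esym; exact: dr.
  - by left; rewrite c_lift'.
have csym := sym_connect_sym (glue_rel_sym c d).
have rep_connect x y : connect (glue_rel c d) x y -> rep y = rep x \/ rep y = d' (rep x).
  case/connectP => p + ->; elim: p x => [|z p IH] x /=; first by left.
  by case/andP => xz /IH[]->; case/rep_step: xz => ->; rewrite ?pairingK; auto.
have connect_rep x : connect (glue_rel c d) x (glue_outer n (rep x)).
  case: x => [[i|k]|k]; try exact: connect0.
  apply: connect1; have := glue_upper_step c d (inl k).
  by rewrite c_lift.
have connect_d' u : connect (glue_rel c d) (glue_outer n u) (glue_outer n (d' u)).
  case: (cupP u) => [||{}u].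
  - rewrite dl; apply: connect1; have := glue_upper_step c d (inr (inord j)).
    by rewrite c_cup.
  - rewrite dr csym; apply: connect1; have := glue_upper_step c d (inr (inord j)).
    by rewrite c_cup.
  - rewrite du; have H v := connect_rep (glue_lower n.+2 v).
    apply: (@connect_trans _ _ (glue_lower n.+2 u)); first by rewrite csym; exact: H.
    by apply: connect_trans (H (d u)); exact/connect1/glue_lower_step.
split.
- apply/forallP => u; apply/forallP => v; apply/eqP; apply/eqP/andP => [<-|[uv]].
    by rewrite eq_sym pairing_neq connect_d'.
  move/rep_connect; rewrite !rep_outer => -[vu|->//]; by rewrite vu eqxx in uv.
- apply: eq_card0 => x; rewrite !inE /=; apply/negP => /andP[_ /existsP]; apply.
  by exists (rep x).
- move=> b; apply/funext => x; case: (skipP j.+2 x) => [||z]; rewrite insertE.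
  + by have := arcs_ofE b d' cup_l; rewrite code_cup_l dl code_cup_r.
  + by have := arcs_ofE b d' cup_r; rewrite code_cup_r dr code_cup_l.
  case: (@codeP b n z) => [u|{}z uz].
    by rewrite -code_lift !arcs_ofE du code_lift.
  rewrite !arcs_of_out // => w; case: (cupP w) => [||u].
  + by rewrite code_cup_l eq_sym skip_neq.
  + by rewrite code_cup_r eq_sym skip_neq.
  + by rewrite code_lift skip_eq.
Qed.
End InsertCup.

(** The numbering [h] sends the top point to 0, the bottom point to 1 and the middle point [k] to
    [k.+2]. The upper edges become those of [d'], of which [e] is the reflection. *)
Lemma loops_glue n (d : diagram 1 n) (e : diagram n 1) (d' : diagram 1 n) : is_flip d' e ->
  nloops e d = loops n (arcs_of true d) (arcs_of false d') /\
  connect (glue_rel e d) (glue_outer n (inl ord0)) (glue_outer n (inr ord0)) =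
  through n (arcs_of true d) (arcs_of false d').
Proof.
move=> /forallP eP.
pose L := arcs_of true d; pose K := arcs_of false d'.
have [LK _ _] : arc_system n L := arcs_of_system _ _.
have [KK _ _] : arc_system n K := arcs_of_system _ _.
pose h (x : glued 1 n 1) : 'I_n.+2 :=
  match x with inl u => inord (code true u) | inr _ => ord0 end.
pose r (x : 'I_n.+2) : glued 1 n 1 :=
  match nat_of_ord x with
  | 0 => inr ord0 | 1 => inl (inl ord0)
  | k.+2 => if insub k is Some k then inl (inr k) else inr ord0
  end.
have h_lower u : h (glue_lower 1 u) = code true u :> nat.
  by rewrite /h /= inordK ?code_lt.
have h_upper u : h (glue_upper 1 (swap_sum u)) = code false u :> nat.
  by case: u => i //=; rewrite inordK //=; have := ltn_ord i; lia.
have hK : cancel h r.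
  case=> [[i|i]|i]; rewrite /r.
  - by rewrite (h_lower (inl i)) (ord1 i).
  - by rewrite (h_lower (inr i)) /= valK.
  - by rewrite (ord1 i).
have rK x : h (r x) = x.
  apply: val_inj; case: x => -[|[|k]] //= xn; first by rewrite inordK.
  rewrite /r /=; case: insubP => [u _ uk|]; last by rewrite -leqNgt; lia.
  by move: uk xn => /= <-; rewrite /= => xn; rewrite inordK.
have h_step x y : glue_rel e d x y -> connect (@arcs n L K) (h x) (h y).
  case/orP => /existsP[u /andP[/eqP-> /eqP->]]; apply: connect1; apply/orP.
    by left; rewrite !h_lower /L arcs_ofE.
  right; have -> : u = swap_sum (swap_sum u) by case: (u).
  by rewrite (eqP (eP _)) !h_upper /K arcs_ofE.
have r_step x y : x \in predT -> @arcs n L K x y -> connect (glue_rel e d) (r x) (r y).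
  move=> _ /orP[] /eqP yx.
    have [x' xx'] : exists x', nat_of_ord x = x' by exists x.
    rewrite xx' in yx; case: (@codeP true n x') => [u|{}x' out] in xx' yx *.
      rewrite /L arcs_ofE in yx.
      have -> : x = h (glue_lower 1 u) by apply: val_inj; rewrite /= h_lower.
      have -> : y = h (glue_lower 1 (d u)) by apply: val_inj; rewrite /= h_lower.
      by rewrite !hK; apply/connect1/glue_lower_step.
    rewrite (_ : y = x) ?connect0 //; apply: val_inj.
    by rewrite /= xx' yx /L arcs_of_out.
  have [x' xx'] : exists x', nat_of_ord x = x' by exists x.
  rewrite xx' in yx; case: (@codeP false n x') => [u|{}x' out] in xx' yx *.
    rewrite /K arcs_ofE in yx.
    have -> : x = h (glue_upper 1 (swap_sum u)) by apply: val_inj; rewrite /= h_upper.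
    have -> : y = h (glue_upper 1 (swap_sum (d' u))) by apply: val_inj; rewrite /= h_upper.
    rewrite !hK; apply: connect1; rewrite -(eqP (eP _)); exact: glue_upper_step.
  rewrite (_ : y = x) ?connect0 //; apply: val_inj.
  by rewrite /= xx' yx /K arcs_of_out.
have e_sym := arcs_sym (m := n) LK KK.
have g_sym := glue_rel_sym e d.
have cl x y : @arcs n L K x y -> (x \in predT) = (y \in predT) by [].
have conn := connect_retract cl (fun _ => isT) h_step r_step hK.
have h0 i : h (inr i) = ord0 by [].
have h1 i : h (inl (inl i)) = inord 1 by [].
split; last by rewrite conn /through h0 h1 (sym_connect_sym e_sym).
rewrite /loops; apply/esym.
have unit_r x : x \in predT -> connect (@arcs n L K) x (h (r x)).
  by rewrite rK.
have := n_comp_retract e_sym g_sym cl (fun _ => isT) h_step r_step hK unit_r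
  (outer_closed LK KK).
move/(_ [pred x | ~~ [exists u, connect (glue_rel e d) x (glue_outer n u)]]).
move=> H; apply: etrans (H _) => [|x].
  by apply: eq_n_comp_r => x; rewrite !inE.
congr negb; rewrite /in_mem /= /outer; apply/idP/existsP.
  by case/orP => hx; [exists (inr ord0)|exists (inl ord0)]; rewrite conn.
by case=> -[i|i]; rewrite conn ?h0 ?h1 => ->; rewrite ?orbT.
Qed.

(** * Combs and elements of F acting below the leftmost leaf *)

Lemma leaves_gt0 t : 0 < leaves t.
Proof. by elim: t => //= l IH r _; rewrite addn_gt0 IH. Qed.

Definition left_comb (k : nat) (t : tree) : tree := iter k (fun u => Node u Leaf) t.

Lemma leaves_left_comb k t : leaves (left_comb k t) = k + leaves t.
Proof. by elim: k => //= k ->; rewrite addn1. Qed.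

Lemma graft_left_comb k t :
  graft (left_comb k Leaf) (t :: nseq k Leaf) = left_comb k t.
Proof.
elim: k => //= k IH; rewrite leaves_left_comb addn1 /=.
have -> : Leaf :: nseq k Leaf = nseq k Leaf ++ [:: Leaf].
  by rewrite -[RHS]/(nseq k Leaf ++ nseq 1 Leaf) -nseqD addn1.
by rewrite take_size_cat ?size_nseq // drop_size_cat ?size_nseq // IH.
Qed.

Definition left_sub t := if t is Node l _ then l else Leaf.
Definition right_sub t := if t is Node _ r then r else Leaf.

Lemma iter_left_sub_graft k t f : size f = k + leaves t ->
  iter k left_sub (graft (left_comb k t) f) = graft t (take (leaves t) f).
Proof.
elim: k f => [|k IH] f sf; first by rewrite take_oversize // sf.
rewrite iterSr /= IH; last by rewrite size_take leaves_left_comb sf; case: ifP; lia.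
by rewrite take_takel // leaves_left_comb leq_addl.
Qed.

(** At depth [k < l] the right subtree grows from a leaf of the comb, and which tree of [f] is glued
    there depends on [t] only through its number of leaves. *)
Lemma right_sub_spine k l t u f : leaves t = leaves u -> k < l ->
  right_sub (iter k left_sub (graft (left_comb l t) f)) =
  right_sub (iter k left_sub (graft (left_comb l u) f)).
Proof.
move=> tu; elim: k l f => [|k IH] [|l] f //= kl.
  by rewrite !leaves_left_comb tu.
by rewrite -!iterS !iterSr /= !leaves_left_comb tu IH.
Qed.

Lemma nleaves_drop_lt (f : seq tree) i j : i < j -> j <= size f ->
  nleaves (drop j f) < nleaves (drop i f).
Proof.
move=> ij jf; rewrite -[in ltnRHS](cat_take_drop (j - i) (drop i f)) drop_drop.
rewrite subnK ?(ltnW ij) // nleaves_cat -[ltnLHS]add0n ltn_add2r.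
case E : (take _ _) => [|t s] /=; last by have := leaves_gt0 t; lia.
by have := congr1 size E; rewrite size_take size_drop /=; case: ifP; lia.
Qed.

Lemma leaves_right_sub_graft l r f : size f = leaves (Node l r) ->
  leaves (right_sub (graft (Node l r) f)) = nleaves (drop (leaves l) f).
Proof. by move=> /= sf; rewrite leaves_graft // size_drop sf addKn. Qed.

Lemma left_comb_subproof m k (f := left_comb k Leaf :: nseq m Leaf) :
  (size f == m.+1) && (nleaves f == (k + m).+1).
Proof.
by rewrite /f /= size_nseq leaves_left_comb nleaves_nseq eqxx /=; apply/eqP; lia.
Qed.
Definition left_comb_forest m k : forest m.+1 (k + m).+1 := Forest (left_comb_subproof m k).

(* The right subtree at depth k of the left spine separates k from any k' > k: in
   the latter case it is the same tree on both sides of the fraction. *)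
Lemma localized_frac_inj (l r l' r' : tree) n m (v : forest 1 m.+1)
    (A B : forall j, forest j.+1 (n + j).+1) :
  leaves (Node l r) = leaves (Node l' r') -> leaves r != leaves r' ->
  (forall j, A j = Node l r :: nseq j Leaf :> seq tree) ->
  (forall j, B j = Node l' r' :: nseq j Leaf :> seq tree) ->
  injective (fun k => frac (A (k + m) \of (left_comb_forest m k \of v))
                           (B (k + m) \of (left_comb_forest m k \of v))).
Proof.
move=> lrE rr' AE BE.
suff H k k' : k < k' -> frac (A (k + m) \of (left_comb_forest m k \of v))
      (B (k + m) \of (left_comb_forest m k \of v)) <>
    frac (A (k' + m) \of (left_comb_forest m k' \of v))
      (B (k' + m) \of (left_comb_forest m k' \of v)).
  by move=> k k' e; case: (ltngtP k k') => // /H; [move/(_ e)|move/(_ (esym e))].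
move=> kk' /fracP[N [p [q []]]].
rewrite !fcompA => /fcompI eA /fcompI eB.
have head_comb j (X : forest (j + m).+1 (n + (j + m)).+1) T :
    X = T :: nseq (j + m) Leaf :> seq tree ->
    exists s, X \of left_comb_forest m j = left_comb j T :: s :> seq tree.
  move=> XE; rewrite /= XE leaves_left_comb addn1 /= nseqD take_cat_size ?size_nseq //.
  by rewrite graft_left_comb; eexists.
have head_graft j (X : forest (j + m).+1 (n + (j + m)).+1) T (s : forest _ N) :
    X = T :: nseq (j + m) Leaf :> seq tree ->
    head Leaf (s \of (X \of left_comb_forest m j)) =
    graft (left_comb j T) (take (j + leaves T) s).
  move=> /head_comb[u uE].
  rewrite -[branches (s \of _)]/(stack s (X \of left_comb_forest m j)) uE /=.
  by rewrite leaves_left_comb.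
set T := Node l r in lrE AE; set U := Node l' r' in lrE BE.
have nT : leaves T = n.+1.
  by have := nleaves_forest (A 0); rewrite AE /= !addn0.
have sizes j (s : forest (n + (j + m)).+1 N) : size (take (j + leaves T) s) = j + leaves T.
  by rewrite size_take size_forest nT; case: ifP; lia.
have hA : head Leaf (p \of (A (k + m) \of left_comb_forest m k)) =
    head Leaf (q \of (A (k' + m) \of left_comb_forest m k')) by rewrite !fcompA eA.
have hB : head Leaf (p \of (B (k + m) \of left_comb_forest m k)) =
    head Leaf (q \of (B (k' + m) \of left_comb_forest m k')) by rewrite !fcompA eB.
rewrite !(head_graft _ _ _ _ (AE _)) in hA.
rewrite !(head_graft _ _ _ _ (BE _)) -lrE in hB.
set f := take (k + leaves T) p in hA hB; have sf : size f = k + leaves T := sizes _ _.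
have sf' : size (take (leaves T) f) = leaves T by rewrite size_take sf; case: ifP; lia.
have : right_sub (graft T (take (leaves T) f)) = right_sub (graft U (take (leaves T) f)).
  have sfU : size f = k + leaves U by rewrite -lrE.
  have := iter_left_sub_graft sfU; rewrite -lrE => <-.
  by rewrite -(iter_left_sub_graft sf) hA hB; apply: right_sub_spine.
(* The two right subtrees carry tails of [f] of different lengths, hence different numbers of
   leaves. *)
move/(congr1 leaves); rewrite !leaves_right_sub_graft -?lrE //.
have := leaves_gt0 r; have := leaves_gt0 r'.
move: lrE rr' sf'; rewrite /= => lrE rr' sf' r'0 r0 e.
have [ll|ll|ll] := ltngtP (leaves l) (leaves l').
- have := nleaves_drop_lt ll (f := take (leaves T) f); rewrite e sf' /=; lia.
- have := nleaves_drop_lt ll (f := take (leaves T) f); rewrite e sf' /=; lia.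
- by move: lrE; rewrite ll => /addnI lrE; rewrite lrE eqxx in rr'.
Qed.

Local Open Scope ring_scope.
Local Open Scope complex_scope.

(** * Inner products of words *)

Section RecAlgebra.
Variable R : realType.
Local Notation Rec m n := {ffun diagram m n -> R[i]}.

Definition single m n (d : diagram m n) : Rec m n := [ffun c => (c == d)%:R].

Lemma scaleCE (u v : R[i]) : u *: (v : R[i]^o) = u * v.
Proof. by []. Qed.

Lemma Rec_decomp m n (x : Rec m n) : x = \sum_d x d *: single d.
Proof.
apply/ffunP => c; rewrite sum_ffunE (bigD1 c) //= [X in _ + X]big1 => [|d /negPf dc].
  by rewrite !ffunE eqxx addr0 [RHS]mulr1.
by rewrite !ffunE eq_sym dc [LHS]mulr0.
Qed.

Lemma id_single n : exists2 d : diagram n n, is_id d & id_Rec R n = single d.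
Proof.
have [d dP] := id_ex n; exists d => //; apply/ffunP => c; rewrite !ffunE.
congr (_%:R); congr nat_of_bool; apply/idP/eqP => [/forallP cP|->//].
have H i : c (inl i) = d (inl i) by rewrite (eqP (cP i)) (eqP (forallP dP i)).
apply: diagramP => -[i|i] //.
by rewrite -(eqP (cP i)) (pairingK c) H (pairingK d).
Qed.

Lemma cup_single : exists2 d : diagram 0 2, d (inr ord0) == inr ord_max & cup R = single d.
Proof.
have [d dP] := cup_ex; exists d => //; apply/ffunP => c; rewrite !ffunE.
congr (_%:R); congr nat_of_bool; apply/idP/eqP => [/eqP cP|->//].
apply: diagramP => -[[]//|i]; have [->|->] : i = ord0 \/ i = ord_max.
- by case: i => [[|[|]]] // ?; [left|right]; apply: val_inj.
- by rewrite cP (eqP dP).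
- by rewrite -[in LHS]cP -(eqP dP) (pairingK c) (pairingK d).
Qed.

Lemma hcat_single m n m' n' (d : diagram m n) (e : diagram m' n') :
  exists2 c : diagram (m + m') (n + n'), is_hcat d e c &
    hcat (single d) (single e) = single c.
Proof.
have [c cP] := hcat_ex d e; exists c => //; apply/ffunP => c'; rewrite !ffunE.
rewrite (bigD1 d) //= (bigD1 e) //= !ffunE !eqxx !mul1r !big1 ?addr0.
- congr (_%:R); congr nat_of_bool; apply/idP/eqP => [/andP[/forallP cl /forallP cr]|->//].
  move/andP: cP => [/forallP cl' /forallP cr']; apply: diagramP => w.
  by case: (hcatP w) => u; rewrite ?(eqP (cl u)) ?(eqP (cl' u)) ?(eqP (cr u)) ?(eqP (cr' u)).
- by move=> i /negPf id; rewrite big1 // => j _; rewrite !ffunE id !mul0r.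
- by move=> j /negPf je; rewrite !ffunE je mulr0 mul0r.
Qed.

Lemma hcat_linear_l m n m' n' (a b : R[i]) (x y : Rec m n) (z : Rec m' n') :
  hcat (a *: x + b *: y) z = a *: hcat x z + b *: hcat y z.
Proof.
apply/ffunP => c; rewrite !ffunE !scaler_sumr -big_split; apply: eq_bigr => d _.
rewrite !scaler_sumr -big_split; apply: eq_bigr => e _; rewrite !ffunE /=.
by rewrite !scaleCE !mulrDl !mulrA.
Qed.

Lemma hcat_linear_r m n m' n' (a b : R[i]) (x y : Rec m' n') (z : Rec m n) :
  hcat z (a *: x + b *: y) = a *: hcat z x + b *: hcat z y.
Proof.
apply/ffunP => c; rewrite !ffunE !scaler_sumr -big_split; apply: eq_bigr => d _.
rewrite !scaler_sumr -big_split; apply: eq_bigr => e _; rewrite !ffunE /=.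
by rewrite !scaleCE mulrDr ![z d * (_ * _)]mulrCA mulrDl !mulrA.
Qed.

Lemma cast_single m n m' n' (em : m = m') (en : n = n') (a b : R[i]) (d e : diagram m n) :
  exists d' e' : diagram m' n', (forall j, inserter j d -> inserter j d') /\
   (forall j, inserter j e -> inserter j e') /\
  cast_Rec em en (a *: single d + b *: single e) = a *: single d' + b *: single e'.
Proof. by case: m' / em; case: n' / en; exists d, e. Qed.

(** Root [i] corresponds to strand [i.*2]; the first term of [rho] places its arc just after this
    strand, the second just before it. *)
Lemma Phi_caret_single (a b : R[i]) i j : exists c c' : diagram _ _,
  [/\ inserter i.*2.+1 c, inserter i.*2 c' &
      Phi_caret a b i j = a *: single c + b *: single c'].
Proof.
have [d1 d1P id1] := id_single 1; have [cu cuP cupE] := cup_single.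
have [di diP idi] := id_single i.*2; have [dj djP idj] := id_single j.*2.
have cu_ins := inserter_cup cuP.
have [e eP eE] := hcat_single d1 cu; have e_ins := inserter_hcat_id d1P cu_ins eP.
have [e' eP' eE'] := hcat_single cu d1.
have e'_ins := inserter_hcat d1P (leqnn 0) (erefl _) cu_ins eP'.
have [f fP fE] := hcat_single (e : diagram 1 3) dj.
have f_ins := inserter_hcat djP (leqnn 1) (erefl _) e_ins fP.
have [f' fP' fE'] := hcat_single (e' : diagram 1 3) dj.
have f'_ins := inserter_hcat djP (leq0n 1) (erefl _) e'_ins fP'.
have [g gP gE] := hcat_single di f; have g_ins := inserter_hcat_id diP f_ins gP.
have [g' gP' gE'] := hcat_single di f'; have g'_ins := inserter_hcat_id diP f'_ins gP'.
rewrite /Phi_caret /rho id1 cupE idi idj eE eE' hcat_linear_l fE fE' hcat_linear_r gE gE'.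
have [c [c' [H [H' ->]]]] := cast_single (strands_bot i j) (strands_top i j) a b g g'.
exists c, c'; split=> //.
  by rewrite -addn1; apply: H.
by rewrite -(addn0 i.*2); apply: H'.
Qed.

End RecAlgebra.

Section Gram.
Variables (R : realType) (delta : R).
Local Notation Rec m n := {ffun diagram m n -> R[i]}.
Local Notation single := (@single R _ _).

(* Only the dependence on b matters; that Rec(1, 1) has dimension one is not used. *)
Definition strand_sum (b : bool) : R[i] :=
  \sum_(c : diagram 1 1) ([forall u, forall v, (c u == v) == (u != v) && b])%:R.

Lemma comp_singleE m n p (e : diagram n p) (d : diagram m n) c :
  comp_Rec delta (single e) (single d) c =
  delta%:C ^+ nloops e d * (is_composite e d c)%:R.
Proof.
rewrite !ffunE (bigD1 e) //= (bigD1 d) //= !ffunE !eqxx !mul1r !big1 ?addr0 //.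
- by move=> i /negPf ie; rewrite big1 // => j _; rewrite !ffunE ie !mul0r.
- by move=> j /negPf jd; rewrite !ffunE jd mulr0 !mul0r.
Qed.

Lemma comp_linear_l m n p (a b : R[i]) (y z : Rec n p) (x : Rec m n) :
  comp_Rec delta (a *: y + b *: z) x = a *: comp_Rec delta y x + b *: comp_Rec delta z x.
Proof.
apply/ffunP => c; rewrite !ffunE !scaler_sumr -big_split; apply: eq_bigr => d _.
rewrite !scaler_sumr -big_split; apply: eq_bigr => e _; rewrite !ffunE /=.
by rewrite !scaleCE !mulrDl !mulrA.
Qed.

Lemma comp_linear_r m n p (a b : R[i]) (y z : Rec m n) (x : Rec n p) :
  comp_Rec delta x (a *: y + b *: z) = a *: comp_Rec delta x y + b *: comp_Rec delta x z.
Proof.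
apply/ffunP => c; rewrite !ffunE !scaler_sumr -big_split; apply: eq_bigr => d _.
rewrite !scaler_sumr -big_split; apply: eq_bigr => e _; rewrite !ffunE /=.
by rewrite !scaleCE mulrDr ![x d * (_ * _)]mulrCA !mulrDl !mulrA.
Qed.

Lemma comp_sum_r m n p (I : finType) (x : Rec n p) (f : I -> R[i]) (y : I -> Rec m n) :
  comp_Rec delta x (\sum_i f i *: y i) = \sum_i f i *: comp_Rec delta x (y i).
Proof.
have comp0 : comp_Rec delta x (0 : Rec m n) = 0.
  by have := comp_linear_r 0 0 (0 : Rec m n) 0 x; rewrite !scale0r !addr0.
elim/big_rec2: _ => // i u v _ <-.
by rewrite -[v]scale1r comp_linear_r !scale1r.
Qed.

Lemma comp_sum_l m n p (I : finType) (x : Rec m n) (f : I -> R[i]) (y : I -> Rec n p) :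
  comp_Rec delta (\sum_i f i *: y i) x = \sum_i f i *: comp_Rec delta (y i) x.
Proof.
have comp0 : comp_Rec delta (0 : Rec n p) x = 0.
  by have := comp_linear_l 0 0 (0 : Rec n p) 0 x; rewrite !scale0r !addr0.
elim/big_rec2: _ => // i u v _ <-.
by rewrite -[v]scale1r comp_linear_l !scale1r.
Qed.

Lemma dagger_decomp m n (y : Rec m n) : dagger y = \sum_d (y d)^* *: dagger (single d).
Proof.
apply/ffunP => c; rewrite sum_ffunE !ffunE; apply: eq_bigr => d _.
rewrite !ffunE (bigD1 d) //= ffunE eqxx rmorph1 mul1r big1 ?addr0 //.
by move=> i /negPf id; rewrite ffunE id rmorph0 mul0r.
Qed.

Lemma scalar_Rec_sum (I : finType) (f : I -> R[i]) (y : I -> Rec 1 1) :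
  scalar_Rec (\sum_i f i *: y i) = \sum_i f i * scalar_Rec (y i).
Proof.
rewrite /scalar_Rec; under eq_bigr do rewrite sum_ffunE.
rewrite exchange_big; apply: eq_bigr => i _; rewrite mulr_sumr.
by apply: eq_bigr => c _; rewrite ffunE.
Qed.

Lemma innerE n (x y : Rec 1 n) :
  inner delta x y = \sum_d \sum_d' x d * (y d')^* * inner delta (single d) (single d').
Proof.
rewrite /inner {1}(Rec_decomp x) (dagger_decomp y) comp_sum_r scalar_Rec_sum.
apply: eq_bigr => d _; rewrite comp_sum_l scalar_Rec_sum mulr_sumr.
by apply: eq_bigr => d' _; rewrite mulrA.
Qed.

Lemma inner_single n (d d' : diagram 1 n) :
  inner delta (single d) (single d') =
  delta%:C ^+ loops n (arcs_of true d) (arcs_of false d') *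
    strand_sum (through n (arcs_of true d) (arcs_of false d')).
Proof.
have [e eP] := flip_ex d'; have [l t] := loops_glue d eP.
have -> : inner delta (single d) (single d') =
    \sum_c comp_Rec delta (single e) (single d) c.
  rewrite /inner; suff -> : dagger (single d') = single e by [].
  apply/ffunP => c; rewrite !ffunE (bigD1 d') //= !ffunE eqxx rmorph1 mul1r big1 ?addr0.
    congr (_%:R); congr nat_of_bool; apply/forallP/eqP => [cP|->]; last exact/forallP.
    apply: diagramP => u; have -> : u = swap_sum (swap_sum u) by case: (u).
    by rewrite (eqP (cP _)) (eqP (forallP eP _)).
  by move=> i /negPf id; rewrite !ffunE id rmorph0 mul0r.
rewrite /strand_sum mulr_sumr; apply: eq_bigr => c _.
rewrite comp_singleE l; congr (_ * (_%:R)); congr nat_of_bool.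
apply: eq_forallb => u; apply: eq_forallb => v; congr (_ == _).
case: (eqVneq u v) => //= uv; rewrite -t.
case: u v uv => [i|i] [j|j]; rewrite (ord1 i) (ord1 j) ?eqxx //= => _.
exact: sym_connect_sym (glue_rel_sym _ _) _ _.
Qed.

End Gram.

Section WordSum.
Variables (R : realType) (delta : R).
Local Notation Rec m n := {ffun diagram m n -> R[i]}.

Lemma inner_sum n (I J : finType) (f : I -> R[i]) (g : J -> R[i])
    (x : I -> Rec 1 n) (y : J -> Rec 1 n) :
  inner delta (\sum_i f i *: x i) (\sum_j g j *: y j) =
  \sum_i \sum_j f i * (g j)^* * inner delta (x i) (y j).
Proof.
have dagger_sum : dagger (\sum_j g j *: y j) = \sum_j (g j)^* *: dagger (y j).
  apply/ffunP => c; rewrite sum_ffunE ffunE.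
  under eq_bigr => d _ do rewrite sum_ffunE rmorph_sum mulr_suml.
  rewrite exchange_big; apply: eq_bigr => j _; rewrite !ffunE scaler_sumr.
  by apply: eq_bigr => d _; rewrite !ffunE /= !scaleCE rmorphM mulrA.
rewrite /inner dagger_sum comp_sum_r scalar_Rec_sum.
apply: eq_bigr => d _; rewrite comp_sum_l scalar_Rec_sum mulr_sumr.
by apply: eq_bigr => d' _; rewrite mulrA.
Qed.

(** The operator maps diagrams to diagrams without a scalar factor. Both codings [b] are covered
    because such operators occur on either side of the inner product. *)
Definition word_op (w : seq nat) n p (X : Rec 1 n -> Rec 1 p) : Prop :=
  exists f : diagram 1 n -> diagram 1 p,
    (forall x, X x = \sum_d x d *: single R (f d)) /\
    forall b d, arcs_of b (f d) = insert_word w (arcs_of b d).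

Lemma word_op_nil n : @word_op [::] n n id.
Proof. by exists id; split=> // x; apply: Rec_decomp. Qed.

(** The top point [j] has code [j.+2], whence the shift. No power of [delta] appears because gluing
    an insertion closes no loop. *)
Lemma word_op_cons w n p j (c : diagram p p.+2) (X : Rec 1 n -> Rec 1 p) :
  (j <= p)%N -> inserter j c -> word_op w X ->
  word_op (j.+2 :: w) (fun x => comp_Rec delta (single R c) (X x)).
Proof.
move=> jp cj [f [Xf wf]].
have /choice[g gP] d := insert_cup_composite jp (f d) cj.
exists g; split=> [x|b d]; last by have [_ _ ->] := gP d; rewrite wf.
rewrite Xf comp_sum_r; apply: eq_bigr => d _; congr (_ *: _).
apply/ffunP => e; rewrite comp_singleE; have [cP -> _] := gP d.
rewrite expr0 mul1r ffunE; congr (_%:R); congr nat_of_bool.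
by apply/idP/eqP => [/(is_composite_unique cP)|->].
Qed.

Lemma inner_word_op w w' n k (X Y : Rec 1 n -> Rec 1 (add2 w n)) x y :
  (0 < n)%N -> word_ok w -> word_ok w' -> pairing_loops w w' = Some k ->
  word_op w X -> word_op w' Y ->
  inner delta (X x) (Y y) = delta%:C ^+ k * inner delta x y.
Proof.
move=> n0 wok wok' wk [f [Xf fw]] [g [Yg gw]].
rewrite Xf Yg inner_sum innerE mulr_sumr; apply: eq_bigr => d _.
rewrite mulr_sumr; apply: eq_bigr => d' _.
rewrite mulrCA; congr (_ * _); rewrite !inner_single fw gw.
have [_ -> ->] := pairing_loopsP n0 wok wok' (arcs_of_system true d)
  (arcs_of_system false d') wk.
by rewrite exprD mulrA.
Qed.

Definition word_sum (I : finType) (w : I -> seq nat) (f : I -> R[i]) n p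
    (Z : Rec 1 n -> Rec 1 p) : Prop :=
  exists X : I -> Rec 1 n -> Rec 1 p,
    (forall i, word_op (w i) (X i)) /\ forall x, Z x = \sum_i f i *: X i x.

Lemma word_sum_id n : @word_sum unit (fun=> [::]) (fun=> 1) n n id.
Proof.
exists (fun=> id); split=> [_|x]; first exact: word_op_nil.
by rewrite (big_pred1 tt) ?scale1r // => -[].
Qed.

Lemma word_sum_comp (I : finType) (w : I -> seq nat) (f : I -> R[i]) n p j
    (co : bool -> R[i]) (cc : bool -> diagram p p.+2) (Z : Rec 1 n -> Rec 1 p) :
  (j < p)%N -> (forall t : bool, inserter (j + t) (cc t)) -> word_sum w f Z ->
  word_sum (fun ti : bool * I => (j + ti.1)%N.+2 :: w ti.2)
    (fun ti => co ti.1 * f ti.2)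
    (fun x => comp_Rec delta
       (co true *: single R (cc true) + co false *: single R (cc false)) (Z x)).
Proof.
move=> jp ccj [X [Xw Zf]].
exists (fun ti x => comp_Rec delta (single R (cc ti.1)) (X ti.2 x)); split=> [ti|x].
  by apply: word_op_cons => //; case: ti.1; lia.
rewrite comp_linear_l Zf !comp_sum_r !scaler_sumr.
rewrite -(pair_bigA _ (fun t i => (co t * f i) *: comp_Rec delta (single R (cc t)) (X i x))).
by rewrite big_bool; congr (_ + _); apply: eq_bigr => i _; rewrite scalerA.
Qed.

Lemma inner_word_sum (I J : finType) (w : I -> seq nat) (w' : J -> seq nat)
    (f : I -> R[i]) (g : J -> R[i]) (k : I -> J -> nat) n p
    (Z Z' : Rec 1 n -> Rec 1 p) x y :
  (0 < n)%N -> (forall i, word_ok (w i)) -> (forall j, word_ok (w' j)) ->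
  (forall i, add2 (w i) n = p) ->
  (forall i j, pairing_loops (w i) (w' j) = Some (k i j)) ->
  word_sum w f Z -> word_sum w' g Z' ->
  inner delta (Z x) (Z' y) =
  (\sum_i \sum_j f i * (g j)^* * delta%:C ^+ k i j) * inner delta x y.
Proof.
move=> n0 wok wok' wp wk [X [Xw ->]] [Y [Yw ->]]; rewrite inner_sum mulr_suml.
apply: eq_bigr => i _; rewrite mulr_suml; apply: eq_bigr => j _.
rewrite -[RHS]mulrA; congr (_ * _).
have := wk i j; have := wok i; have := wok' j; move: (X i) (Y j) (Xw i) (Yw j).
rewrite -(wp i) => Xi Yj Xwi Ywj wokj woki wij.
exact: inner_word_op n0 woki wokj wij Xwi Ywj.
Qed.

End WordSum.

(* The state of three branchings, the last one first; [true] selects the term of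
   [rho] with coefficient [a]. *)
Notation bool3 := (bool * (bool * (bool * unit)))%type.

Definition bits (t : bool3) : nat :=
  if t.1 then if t.2.1 then if t.2.2.1 then 7 else 6
              else if t.2.2.1 then 5 else 4
  else if t.2.1 then if t.2.2.1 then 3 else 2
              else if t.2.2.1 then 1 else 0.

(* Numbers of loops for the 64 pairs of states of [(.(.Y))], [((.Y).)]. *)
Definition right_table : seq (seq nat) :=
  [:: [:: 3; 2; 2; 1; 2; 1; 1; 0];
      [:: 2; 1; 1; 2; 1; 0; 0; 1];
      [:: 2; 1; 1; 0; 1; 2; 0; 1];
      [:: 1; 0; 0; 1; 0; 1; 1; 2];
      [:: 2; 3; 1; 2; 1; 2; 0; 1];
      [:: 1; 2; 2; 3; 0; 1; 1; 2];
      [:: 1; 2; 0; 1; 2; 3; 1; 2];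
      [:: 0; 1; 1; 2; 1; 2; 2; 3]].

(* The same for the mirror images [((Y.).)], [(.(Y.))]. *)
Definition left_table : seq (seq nat) :=
  [:: [:: 3; 2; 2; 1; 2; 1; 1; 0];
      [:: 2; 1; 3; 2; 1; 0; 2; 1];
      [:: 2; 1; 1; 0; 3; 2; 2; 1];
      [:: 1; 0; 2; 1; 2; 1; 3; 2];
      [:: 2; 1; 1; 0; 1; 0; 0; 1];
      [:: 1; 0; 2; 1; 0; 1; 1; 2];
      [:: 1; 0; 0; 1; 2; 1; 1; 2];
      [:: 0; 1; 1; 2; 1; 2; 2; 3]].

Definition lookup (T : seq (seq nat)) (t u : bool3) : nat :=
  nth 0%N (nth [::] T (bits t)) (bits u).

(** Carets at the roots [i1], [i2], [i3] in this order. A bit is added when the [a] term of [rho] is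
    chosen, and [.+2] passes from strands to codes. *)
Definition caret_word (i1 i2 i3 : nat) (t : bool3) : seq nat :=
  [:: (i3.*2 + t.1).+2; (i2.*2 + t.2.1).+2; (i1.*2 + t.2.2.1).+2]%N.

Lemma right_tableP t u :
  pairing_loops (caret_word 0 1 2 t) (caret_word 0 0 1 u) = Some (lookup right_table t u).
Proof. by case: t => [[] [[] [[] []]]]; case: u => [[] [[] [[] []]]]. Qed.

Lemma left_tableP t u :
  pairing_loops (caret_word 0 0 0 t) (caret_word 0 1 1 u) = Some (lookup left_table t u).
Proof. by case: t => [[] [[] [[] []]]]; case: u => [[] [[] [[] []]]]. Qed.

(** * Closed forms of the vacuum coefficients *)

Section Kappa.
Variables (F : comNzRingType) (A B D : F).

Let co (t : bool) : F := if t then A else B.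

Definition caret_coef (t : bool3) : F := co t.1 * (co t.2.1 * (co t.2.2.1 * 1)).

Definition kappa (T : seq (seq nat)) : F :=
  \sum_t \sum_u caret_coef t * caret_coef u * D ^+ lookup T t u.

Lemma sum_bool3 (f : bool3 -> F) : \sum_t f t =
  \sum_(x : bool) \sum_(y : bool) \sum_(z : bool) f (x, (y, (z, tt))).
Proof.
rewrite (eq_bigr (fun t : bool3 => f (t.1, t.2))) => [|[]] //.
rewrite -(pair_bigA _ (fun x t => f (x, t))); apply: eq_bigr => x _ /=.
rewrite (eq_bigr (fun t => f (x, (t.1, t.2)))) => [|[]] //.
rewrite -(pair_bigA _ (fun y t => f (x, (y, t)))); apply: eq_bigr => y _ /=.
rewrite (eq_bigr (fun t => f (x, (y, (t.1, t.2))))) => [|[]] //.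
rewrite -(pair_bigA _ (fun z t => f (x, (y, (z, t))))); apply: eq_bigr => z _ /=.
by rewrite (big_pred1 tt) // => -[].
Qed.

Hypothesis hAB : D * (A ^+ 2 + B ^+ 2) + 2 * A * B = 1.

(* Cofactor of the relation hAB in [kappa T] minus its closed form. *)
Let Q : F := 1 + D * B ^+ 2 + D ^+ 2 * B ^+ 4 + 2 * A * B + 4 * D * A * B ^+ 3 +
  D * A ^+ 2 + 6 * A ^+ 2 * B ^+ 2 + 4 * D * A ^+ 3 * B + D ^+ 2 * A ^+ 4.

Lemma kappa_right :
  kappa right_table = 1 - (A * B) ^+ 2 * (D ^+ 2 - 1) * (2 - D * A ^+ 2).
Proof.
transitivity (1 - (A * B) ^+ 2 * (D ^+ 2 - 1) * (2 - D * A ^+ 2) +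
    (D * (A ^+ 2 + B ^+ 2) + 2 * A * B - 1) * Q).
  rewrite /kappa sum_bool3 !big_bool !sum_bool3 !big_bool /lookup /caret_coef /co /Q /=.
  by ring.
by rewrite hAB subrr mul0r addr0.
Qed.

Lemma kappa_left :
  kappa left_table = 1 - (A * B) ^+ 2 * (D ^+ 2 - 1) * (2 - D * B ^+ 2).
Proof.
transitivity (1 - (A * B) ^+ 2 * (D ^+ 2 - 1) * (2 - D * B ^+ 2) +
    (D * (A ^+ 2 + B ^+ 2) + 2 * A * B - 1) * Q).
  rewrite /kappa sum_bool3 !big_bool !sum_bool3 !big_bool /lookup /caret_coef /co /Q /=.
  by ring.
by rewrite hAB subrr mul0r addr0.
Qed.
End Kappa.

(* If both vanish then [a^2 = b^2], and [d] is a root of [5 d^2 + 15 d + 12] or of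
   [5 d^2 - 15 d + 12], which are positive. *)
Lemma kappa_neq0 (R : realFieldType) (a b d : R) :
  d * (a ^+ 2 + b ^+ 2) + 2 * a * b = 1 ->
  kappa a b d right_table != 0 \/ kappa a b d left_table != 0.
Proof.
move=> hab; rewrite kappa_right // kappa_left //.
have [e eE] : exists e, e = (a * b) ^+ 2 * (d ^+ 2 - 1) by eexists.
rewrite -eE.
have [ka|] := eqVneq (1 - e * (2 - d * a ^+ 2)) 0; last by left.
have [kb|] := eqVneq (1 - e * (2 - d * b ^+ 2)) 0; last by right.
exfalso; have e1 : e * (2 - d * a ^+ 2) = 1 by rewrite -[LHS](subKr 1) ka subr0.
have e2 : e * (2 - d * b ^+ 2) = 1 by rewrite -[LHS](subKr 1) kb subr0.
have e0 : e != 0 by apply/eqP => e0; move: e1; rewrite e0 mul0r => /esym/eqP; rewrite oner_eq0.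
have d0 : d != 0.
  (* At [d = 0] the relation says $2ab = 1$, whereas [e1] forces $(2ab)^2 = -2$. *)
  apply/eqP => d0; move: e1 hab; rewrite eE d0 !mul0r subr0 add0r => e1 ab.
  have : (2 * a * b) ^+ 2 = - 2.
    have -> : (2 * a * b) ^+ 2 = (a * b) ^+ 2 * (0 ^+ 2 - 1) * 2 * (- 2) by ring.
    by rewrite e1 mul1r.
  by rewrite ab; lra.
have /eqP : (e * d) * ((a - b) * (a + b)) = 0.
  have -> : (e * d) * ((a - b) * (a + b)) = e * (2 - d * b ^+ 2) - e * (2 - d * a ^+ 2) by ring.
  by rewrite e1 e2 subrr.
rewrite !mulf_eq0 (negPf e0) (negPf d0) /= subr_eq0 addr_eq0 => /orP[/eqP ab|/eqP ab].
  have u1 : 2 * b ^+ 2 * (d + 1) = 1 by rewrite -[RHS]hab ab; ring.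
  have : (d - 1) * (4 * (d + 1) - d * (2 * b ^+ 2 * (d + 1))) * (2 * b ^+ 2 * (d + 1)) ^+ 2 =
      8 * (d + 1) ^+ 2 * (e * (2 - d * b ^+ 2)).
    by rewrite eE ab; ring.
  (* What remains contradicts $5d^2+15d+12 = \frac54(2d+3)^2 + \frac34 > 0$; the other sign of [a]
     gives the same with $2d-3$. *)
  by rewrite u1 e2; have := sqr_ge0 (2 * d + 3); nra.
have u1 : 2 * b ^+ 2 * (d - 1) = 1 by rewrite -[RHS]hab ab; ring.
have : (d + 1) * (4 * (d - 1) - d * (2 * b ^+ 2 * (d - 1))) * (2 * b ^+ 2 * (d - 1)) ^+ 2 =
    8 * (d - 1) ^+ 2 * (e * (2 - d * b ^+ 2)).
  by rewrite eE ab; ring.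
by rewrite u1 e2; have := sqr_ge0 (2 * d - 3); nra.
Qed.

Section Carets.
Variables (R : realType) (delta : R) (a b : R[i]).
Hypotheses (a_real : Num.conj a = a) (b_real : Num.conj b = b).
Local Notation Rec m n := {ffun diagram m n -> R[i]}.
Local Notation comp := (comp_Rec delta).

Let co (t : bool) : R[i] := if t then a else b.

(** The ascribed type is convertible to the one with [(i + j).+2.*2.-1] strands, so a caret can be
    read as the insertion of two points. *)
Lemma word_sum_caret (I : finType) (w : I -> seq nat) (f : I -> R[i]) n i j
    (Z : Rec 1 n -> Rec 1 (i + j).+1.*2.-1) :
  word_sum w f Z ->
  word_sum (fun ti : bool * I => (i.*2 + ti.1)%N.+2 :: w ti.2)
    (fun ti => co ti.1 * f ti.2)
    (fun x => comp (Phi_caret a b i j) (Z x) : Rec 1 (i + j).+1.*2.-1.+2).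
Proof.
move=> wZ; have [c [c' [cj cj' ->]]] := Phi_caret_single a b i j.
pose cc t : diagram (i + j).+1.*2.-1 (i + j).+1.*2.-1.+2 := if t then c else c'.
apply: (@word_sum_comp _ _ _ _ _ _ _ i.*2 co cc) wZ => [|[]]; first by lia.
  by rewrite addn1.
by rewrite addn0.
Qed.

Let conj_coef t : Num.conj (caret_coef a b t) = caret_coef a b t.
Proof.
have conjM (x y z : R[i]) : Num.conj (x * (y * z)) =
  Num.conj x * (Num.conj y * Num.conj z) by rewrite !rmorphM.
case: t => [[] [[] [[] []]]]; rewrite /caret_coef /= mulr1;
  by apply: etrans (conjM _ _ _) _; rewrite ?a_real ?b_real.
Qed.

(** Every pair of states contributes a power of [delta] times the same [inner delta x y], so the sum
    over states factors out. Real [a] and [b] remove the conjugation on the second side. *)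
Lemma inner_right m (P0 : Rec m.+1.*2.-1 m.+2.*2.-1)
    (P1 Q1 : Rec m.+2.*2.-1 m.+3.*2.-1) (P2 Q2 : Rec m.+3.*2.-1 m.+4.*2.-1) x y :
  P0 = Phi_caret a b 0 m -> P1 = Phi_caret a b 1 m -> P2 = Phi_caret a b 2 m ->
  Q1 = Phi_caret a b 0 m.+1 -> Q2 = Phi_caret a b 1 m.+1 ->
  inner delta (comp P2 (comp P1 (comp P0 x))) (comp Q2 (comp Q1 (comp P0 y))) =
  kappa a b delta%:C right_table * inner delta x y.
Proof.
move=> -> -> -> -> ->.
pose w0 := @word_sum_id R m.+1.*2.-1.
pose w1 := @word_sum_caret _ _ _ _ 0 m _ w0.
pose wl := @word_sum_caret _ _ _ _ 2 m _ (@word_sum_caret _ _ _ _ 1 m _ w1).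
pose wr := @word_sum_caret _ _ _ _ 1 m.+1 _ (@word_sum_caret _ _ _ _ 0 m.+1 _ w1).
rewrite (inner_word_sum delta x y (k := lookup right_table) _ _ _ _ _ wl wr) //.
- by congr (_ * _); apply: eq_bigr => t _; apply: eq_bigr => u _; rewrite conj_coef.
- by case=> [[] [[] [[] []]]].
- by case=> [[] [[] [[] []]]].
- exact: right_tableP.
Qed.

Lemma inner_left m (P0 : Rec m.+1.*2.-1 m.+2.*2.-1)
    (P1 Q1 : Rec m.+2.*2.-1 m.+3.*2.-1) (P2 Q2 : Rec m.+3.*2.-1 m.+4.*2.-1) x y :
  P0 = Phi_caret a b 0 m -> P1 = Phi_caret a b 0 m.+1 -> P2 = Phi_caret a b 0 m.+2 ->
  Q1 = Phi_caret a b 1 m -> Q2 = Phi_caret a b 1 m.+1 ->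
  inner delta (comp P2 (comp P1 (comp P0 x))) (comp Q2 (comp Q1 (comp P0 y))) =
  kappa a b delta%:C left_table * inner delta x y.
Proof.
move=> -> -> -> -> ->.
pose w0 := @word_sum_id R m.+1.*2.-1.
pose w1 := @word_sum_caret _ _ _ _ 0 m _ w0.
pose wl := @word_sum_caret _ _ _ _ 0 m.+2 _ (@word_sum_caret _ _ _ _ 0 m.+1 _ w1).
pose wr := @word_sum_caret _ _ _ _ 1 m.+1 _ (@word_sum_caret _ _ _ _ 1 m _ w1).
rewrite (inner_word_sum delta x y (k := lookup left_table) _ _ _ _ _ wl wr) //.
- by congr (_ * _); apply: eq_bigr => t _; apply: eq_bigr => u _; rewrite conj_coef.
- by case=> [[] [[] [[] []]]].
- by case=> [[] [[] [[] []]]].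
- exact: left_tableP.
Qed.
End Carets.

(** * Hilbert space estimates *)

Section Hilbert.
Variable R : realType.

Lemma norm_cabs (z : R[i]) : `|z| = (cabs z)%:C.
Proof. exact/esym/RRe_real/normr_real. Qed.

Lemma cabs_ge0 (z : R[i]) : 0 <= cabs z.
Proof. by rewrite -ler0c -norm_cabs. Qed.

Lemma cabsM (z w : R[i]) : cabs (z * w) = cabs z * cabs w.
Proof. by apply: complexI; rewrite rmorphM /= -!norm_cabs normrM. Qed.

Lemma cabsD (z w : R[i]) : cabs (z + w) <= cabs z + cabs w.
Proof. by rewrite -lecR rmorphD /= -!norm_cabs ler_normD. Qed.

Lemma cabs_gt0 (z : R[i]) : (0 < cabs z) = (z != 0).
Proof. by rewrite -normr_gt0 norm_cabs ltcR. Qed.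

Lemma cabsN (z : R[i]) : cabs (- z) = cabs z.
Proof. by apply: complexI; rewrite -!norm_cabs normrN. Qed.

Variables (H : lmodType R[i]) (ip : {dot H for Num.conj}).

Lemma hnorm_ge0 u : 0 <= hnorm ip u.
Proof. exact: sqrtr_ge0. Qed.

Lemma hnorm_sqr u : (hnorm ip u ^+ 2)%:C = ip u u.
Proof.
have /RRe_real E : ip u u \is Num.real by rewrite realE dnorm_ge0.
rewrite -[RHS]E sqr_sqrtr // -ler0c E; exact: dnorm_ge0.
Qed.

Lemma cauchy_schwarz u v : cabs (ip u v) <= hnorm ip u * hnorm ip v.
Proof.
have [->|v0] := eqVneq v 0.
  rewrite linear0r (_ : cabs 0 = 0) ?mulr_ge0 ?hnorm_ge0 //.
  by apply: complexI; rewrite -norm_cabs normr0.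
have vv0 : 0 < ip v v by rewrite dnorm_gt0.
rewrite -(@ler_pXn2r _ 2) ?nnegrE ?cabs_ge0 ?mulr_ge0 ?hnorm_ge0 //.
have hE : ((hnorm ip u * hnorm ip v) ^+ 2)%:C = ip u u * ip v v.
  by rewrite exprMn -!hnorm_sqr -rmorphM.
rewrite -lecR {}hE (_ : (cabs _ ^+ 2)%:C = `|ip u v| ^+ 2); last by rewrite norm_cabs -rmorphXn.
set c := ip u v / ip v v; set w := u - c *: v.
have vw : ip w v = 0.
  by rewrite linearBl /= linearZl_LR /= /c divfK ?subrr // gt_eqF.
have wv : ip (c *: v) w = 0.
  rewrite linearZl_LR /= hermC /= vw rmorph0 !mulr0 //.
have uE : c *: v + w = u by rewrite addrC subrK.
have uu : ip u u = `|c| ^+ 2 * ip v v + ip w w.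
  by rewrite -[in LHS]uE -(dnormZ ip); exact: hnormDd.
have -> : ip u v = c * ip v v by rewrite -uE linearDl /= vw addr0 linearZl_LR.
rewrite normrM exprMn (ger0_norm (ltW vv0)) uu mulrDl.
have -> : `|c| ^+ 2 * ip v v ^+ 2 = `|c| ^+ 2 * ip v v * ip v v.
  by rewrite -mulrA; congr (_ * _); exact: expr2.
by rewrite lerDl mulr_ge0 ?dnorm_ge0.
Qed.

Lemma hnormD u v : hnorm ip (u + v) <= hnorm ip u + hnorm ip v.
Proof.
rewrite -(@ler_pXn2r _ 2) ?nnegrE ?addr_ge0 ?hnorm_ge0 // -lecR hnorm_sqr.
have := dnormD ip u v; rewrite /= => ->.
have dE : ip u v + Num.conj (ip u v) = (2 * complex.Re (ip u v))%:C.
  by rewrite rmorphM rmorph_nat -addcJ.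
rewrite dE -!hnorm_sqr -!rmorphD /= lecR sqrrD.
have := cauchy_schwarz u v; have := normc_ge_Re (ip u v); rewrite norm_cabs lecR.
have := ler_norm (complex.Re (ip u v)); lra.
Qed.

(** The [+ 1] in the bound on [M] absorbs the norm of [u'], which exceeds that of [u] by at most
    [eps]. *)
Lemma cabs_ip_approx u v u' v' eps M : 0 <= eps <= 1 ->
  hnorm ip u + hnorm ip v + 1 <= M ->
  hnorm ip (u - u') <= eps -> hnorm ip (v - v') <= eps ->
  cabs (ip u v - ip u' v') <= eps * M.
Proof.
move=> /andP[e0 e1] uvM uu' vv'.
have -> : ip u v - ip u' v' = ip (u - u') v + ip u' (v - v').
  by rewrite linearBl linearBr /= addrA subrK.
have u'E : hnorm ip u' <= hnorm ip u + eps.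
  have := hnormD u (u' - u); rewrite addrC subrK => /le_trans; apply.
  rewrite lerD2l; apply: le_trans uu'; rewrite -ler_sqr ?nnegrE ?hnorm_ge0 // -lecR !hnorm_sqr.
  by rewrite -opprB hnormN.
apply: le_trans (cabsD _ _) _.
have cs1 := cauchy_schwarz (u - u') v; have cs2 := cauchy_schwarz u' (v - v').
have := hnorm_ge0 v; have := hnorm_ge0 u; have := hnorm_ge0 u'.
have := hnorm_ge0 (u - u'); have := hnorm_ge0 (v - v').
move=> h1 h2 h3 h4 h5.
have k1 : hnorm ip (u - u') * hnorm ip v <= eps * hnorm ip v by apply: ler_wpM2r.
have k2 : hnorm ip u' * hnorm ip (v - v') <= (hnorm ip u + 1) * eps.
  by apply: ler_pM => //; lra.
nra.
Qed.
End Hilbert.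

(** * Coefficients of the Jones representation *)

Lemma forest1_gt0 n (t : forest 1 n) : (0 < n)%N.
Proof.
have := size_forest t; have := nleaves_forest t; case: (branches t) => [|u [|]] //= <- _.
by rewrite addn0 leaves_gt0.
Qed.

Section Jones.
Variables (R : realType) (delta : R) (a b : R[i]) (J : jones_rep delta a b).
Local Notation Phi := (jones_Phi J).
Local Notation ip := (jones_ip J).
Local Notation iota := (@jones_iota _ _ _ _ J _).
Local Notation span := (tree_span Phi).
Local Notation comp := (comp_Rec delta).

Lemma span_comp n m (f : forest n m) x : span x -> span (comp (Phi f) x).
Proof.
move=> [k [c [s ->]]]; exists k, c, (fun i => f \of s i).
by rewrite comp_sum_r; apply: eq_bigr => i _; rewrite (Phi_fcomp (jones_functor J)).
Qed.

(** A vector of the span is a combination of values of [Phi], so the identity reduces to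
    functoriality and the associativity of forests. *)
Lemma span_compA k n m (f : forest n m) (g : forest k n) x : span (n := k) x ->
  comp (Phi (f \of g)) x = comp (Phi f) (comp (Phi g) x).
Proof.
move=> [N [c [s ->]]]; rewrite !comp_sum_r; apply: eq_bigr => i _.
have PhiM := Phi_fcomp (jones_functor J).
by rewrite -(PhiM _ _ _ (f \of g) (s i)) -(PhiM _ _ _ g (s i)) -(PhiM _ _ _ f (g \of s i)) fcompA.
Qed.

Lemma approx_pair (u v : jones_space J) (eps : R) : 0 < eps ->
  exists m (t : forest 1 m.+1) x y, [/\ span x, span y,
    hnorm ip (u - iota t x) < eps & hnorm ip (v - iota t y) < eps].
Proof.
move=> e0; have [n1 [t1 [x [xs xe]]]] := jones_iota_dense u e0.
have [n2 [t2 [y [ys ye]]]] := jones_iota_dense v e0.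
have [k [p [q pq]]] := fcomp_ore t1 t2; have := forest1_gt0 (p \of t1).
case: k p q pq => // k p q pq _.
exists k, (p \of t1), (comp (Phi p) x), (comp (Phi q) y).
split; try exact: span_comp; first by rewrite jones_iota_compatible.
by rewrite pq jones_iota_compatible.
Qed.

(** The group element carries [x] to the space of [A \of v] through [Phi B], while compatibility
    carries [y] to the same space through [Phi A]. *)
Lemma ip_pi_localized m N (v : forest 1 m) (A B : forest m N) x y : span x -> span y ->
  ip (jones_pi J (frac (A \of v) (B \of v)) (iota v x)) (iota v y) =
  inner delta (comp (Phi B) x) (comp (Phi A) y).
Proof.
move=> xs ys; rewrite (@jones_pi_frac _ _ _ _ J _ _ _ (A \of v) (B \of v) v fid B) ?fcomp1f //.
rewrite -(jones_iota_compatible v A ys) jones_iota_isometric //; exact: span_comp.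
Qed.

Lemma pi_norm g u : hnorm ip (jones_pi J g u) = hnorm ip u.
Proof. by have [_ piU _ _] := jones_pi_unitary J; rewrite /hnorm piU. Qed.

Lemma pi_sub g u v : jones_pi J g (u - v) = jones_pi J g u - jones_pi J g v.
Proof.
have [piL _ _ _] := jones_pi_unitary J.
by rewrite -[- v]scaleN1r addrC piL scaleN1r addrC.
Qed.

(* For [x], [y] in the space of a tree [v] the elements acting as A/B below the
   leftmost leaf of ever deeper extensions of [v] have the coefficient
   [kap * ip x y]. *)
Lemma not_c0_of_local_scalar (kap : R[i]) (l r l' r' : tree) n
    (A B : forall j, forest j.+1 (n + j)%N.+1) :
  kap != 0 -> leaves (Node l r) = leaves (Node l' r') -> leaves r != leaves r' ->
  (forall j, A j = Node l r :: nseq j Leaf :> seq tree) ->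
  (forall j, B j = Node l' r' :: nseq j Leaf :> seq tree) ->
  (forall j x y, span x -> span y ->
     inner delta (comp (Phi (B j)) x) (comp (Phi (A j)) y) = kap * inner delta x y) ->
  forall eta zeta, (exists g, ip (jones_pi J g eta) zeta <> 0) ->
    ~ c0 (fun g => ip (jones_pi J g eta) zeta).
Proof.
move=> kap0 lrE rr' AE BE AB eta zeta [g0 /eqP z0] Hc0.
(* The coefficient of [eta] at [gam k * g0] is that of [u] at [gam k], so only a nonzero [ip u zeta]
   is needed. *)
set u := jones_pi J g0 eta in z0.
pose M := hnorm ip u + hnorm ip zeta + 1.
have M1 : 1 <= M by rewrite /M; have := hnorm_ge0 ip u; have := hnorm_ge0 ip zeta; lra.
pose K := cabs kap; pose Z := cabs (ip u zeta).
have K0 : 0 < K by rewrite cabs_gt0.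
have Z0 : 0 < Z by rewrite cabs_gt0.
(* An error [eps * M] arises at [gam k], and another, multiplied by [K], at the identity; together
   they take at most half of [K * Z]. *)
pose eps := Num.min 1 (K * Z / (2 * M * (1 + K))).
have D0 : 0 < 2 * M * (1 + K) by apply: mulr_gt0; lra.
have eps0 : 0 < eps by rewrite lt_min ltr01 /= divr_gt0 // mulr_gt0.
have eps1 : eps <= 1 by rewrite ge_min lexx.
have epsM : eps * M * (1 + K) <= K * Z / 2.
  have : eps <= K * Z / (2 * M * (1 + K)) by rewrite ge_min lexx orbT.
  by rewrite ler_pdivlMr //; lra.
have [m [v [x [y [xs ys ux zy]]]]] := approx_pair u zeta eps0.
pose gam k := frac (A (k + m)%N \of (left_comb_forest m k \of v))
                   (B (k + m)%N \of (left_comb_forest m k \of v)).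
have gam_inj : injective gam by exact: (localized_frac_inj lrE rr' AE BE).
have eps01 : 0 <= eps <= 1 by rewrite (ltW eps0).
have gamE k : ip (jones_pi J (gam k) (iota v x)) (iota v y) = kap * ip (iota v x) (iota v y).
  rewrite -(jones_iota_compatible v (left_comb_forest m k) xs).
  rewrite -(jones_iota_compatible v (left_comb_forest m k) ys).
  rewrite ip_pi_localized ?AB ?jones_iota_isometric //; exact: span_comp.
have close k : cabs (ip (jones_pi J (gam k) u) zeta - kap * ip (iota v x) (iota v y)) <= eps * M.
  rewrite -(gamE k); apply: cabs_ip_approx => //; last exact: ltW zy.
    by rewrite pi_norm.
  by rewrite -pi_sub pi_norm ltW.
have close1 : cabs (ip u zeta - ip (iota v x) (iota v y)) <= eps * M.
  by apply: cabs_ip_approx => //; [exact: ltW ux|exact: ltW zy].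
have large k : K * Z / 2 <= cabs (ip (jones_pi J (gam k) u) zeta).
  set w := ip (iota v x) (iota v y) in close close1.
  have h1 : Z <= cabs w + eps * M.
    rewrite /Z -[ip u zeta](subrK w); apply: le_trans (cabsD _ _) _; lra.
  have h2 : K * cabs w <= cabs (ip (jones_pi J (gam k) u) zeta) + eps * M.
    rewrite -cabsM -[kap * w](subrK (ip (jones_pi J (gam k) u) zeta)).
    apply: le_trans (cabsD _ _) _; rewrite -opprB cabsN.
    have := close k; lra.
  have : K * Z <= K * (cabs w + eps * M) by rewrite ler_pM2l.
  nra.
have KZ0 : 0 < K * Z / 2 by rewrite divr_gt0 ?mulr_gt0.
have [_ _ _ piM] := jones_pi_unitary J.
apply: infinite_nat; apply: sub_finite_set (finite_preimage
  (f := fun k => (gam k * g0)%g) _ (Hc0 _ KZ0)) => [k _ /=|k k' _ _ /mulIg/gam_inj//].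
by rewrite piM.
Qed.

End Jones.

Lemma conj_real (R : realType) (x : R) : Num.conj x%:C = x%:C.
Proof. exact: conjc_real. Qed.

(** * Coefficients of the left regular representation *)

Section Regular.
Variables (R : realType) (G : groupType).

Definition point_mass (g : G) : G -> R[i] := fun h => (h == g)%:R.

Lemma l2norm2_point_mass g : l2norm2 (point_mass g) = 1%E.
Proof.
rewrite /l2norm2 -(@esum_set1 R _ g (fun=> 1%E)) // [RHS]esum_mkcond.
apply: eq_esum => h _; rewrite /point_mass.
rewrite (_ : (h \in [set g]%classic) = (h == g)); last by apply/idP/eqP; rewrite inE //=.
case: eqP => _; rewrite /cabs; first by rewrite normr1 /= expr1n.
by rewrite normr0 /= expr0n.
Qed.

Lemma l2norm2_two_points (c : R[i]) g g' : g != g' ->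
  l2norm2 (fun h => c * point_mass g h + point_mass g' h) = (cabs c ^+ 2 + 1)%:E.
Proof.
move=> gg'; rewrite EFinD -(@esum_set1 R _ g (fun=> (cabs c ^+ 2)%:E)) ?lee_fin ?sqr_ge0 //.
rewrite -[X in (_ + X)%E](@esum_set1 R _ g' (fun=> 1%E)) //.
rewrite [X in (X + _)%E]esum_mkcond [X in (_ + X)%E]esum_mkcond -esumD; first last.
- by move=> h _; case: ifP.
- by move=> h _; case: ifP; rewrite ?lee_fin ?sqr_ge0.
apply: eq_esum => h _; rewrite /point_mass.
have in1 (x : G) : (h \in [set x]%classic) = (h == x) by apply/idP/eqP; rewrite inE //=.
rewrite !in1; case: (eqVneq h g) => [->|_].
  by rewrite (negPf gg') mulr1 addr0 adde0.
rewrite mulr0 add0r add0e; case: eqP => _; rewrite /cabs.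
  by rewrite normr1 /= expr1n.
by rewrite normr0 /= expr0n.
Qed.

Variables (H : lmodType R[i]) (ip : {dot H for Num.conj}) (pi : G -> H -> H).

(* [V] is only assumed to preserve norms; orthogonality follows by polarization. *)
Lemma regular_coefficient : contains_left_regular ip pi ->
  exists eta, forall g, ip (pi g eta) eta = (g == 1%g)%:R.
Proof.
move=> [V [V_lin V_norm V_pi]]; exists (V (point_mass 1%g)) => g.
have l2_pm h : l2 (point_mass h) by rewrite /l2 l2norm2_point_mass ltry.
have V1 h : ip (V (point_mass h)) (V (point_mass h)) = 1.
  by rewrite V_norm // l2norm2_point_mass.
rewrite -V_pi //.
have -> : left_translate g (point_mass 1%g) = point_mass g.
  apply/funext => h; rewrite /left_translate /point_mass; congr (_%:R).
  congr nat_of_bool; apply/eqP/eqP => [e|->]; last exact: mulVg.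
  by rewrite -[h]mul1g -(mulgV g) -mulgA e mulg1.
have [->|g1] := eqVneq g 1%g; first exact: V1.
(* With this [c] the cross terms of the square norm of [c *: x + y] add up to $2|z|^2$, while
   preservation of norms gives $|c|^2 + 1$; hence [z] vanishes. *)
set x := V _; set y := V _; pose z := ip x y; pose c := Num.conj z.
have l2_sum : l2 (fun h => c * point_mass g h + point_mass 1%g h).
  by rewrite /l2 l2norm2_two_points // ltry.
have := V_norm _ l2_sum; rewrite V_lin // l2norm2_two_points //=.
rewrite -/x -/y.
have -> : ip (c *: x + y) (c *: x + y) =
    `|c| ^+ 2 + 1 + (c * z + Num.conj (c * z)).
  rewrite (dnormD ip) (dnormZ ip) !V1 mulr1; congr (_ + (_ + Num.conj _)).
    by rewrite linearZl_LR.
  by rewrite linearZl_LR.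
rewrite norm_cabs -rmorphXn -(rmorph1 (real_complex R)) -rmorphD => /eqP.
rewrite -subr_eq0 addrAC subrr add0r.
have -> : c * z = (cabs z ^+ 2)%:C by rewrite /c mulrC -normCK norm_cabs -rmorphXn.
rewrite (conj_real (cabs z ^+ 2)) -rmorphD => /eqP/complexI zz.
have /eqP : cabs z ^+ 2 = 0 by lra.
rewrite sqrf_eq0; have [//|/[dup] + _] := eqVneq z 0.
by rewrite -cabs_gt0 => /gt_eqF ->.
Qed.
End Regular.

(** Transfers nonvanishing from the ordered field of reals, where it rests on positivity, to the
    complex scalars. *)
Lemma kappa_rmorph (F F' : comNzRingType) (f : {rmorphism F -> F'}) (A B D : F) T :
  kappa (f A) (f B) (f D) T = f (kappa A B D T).
Proof.
have coE s : caret_coef (f A) (f B) s = f (caret_coef A B s).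
  by case: s => [[] [[] [[] []]]]; rewrite /caret_coef !rmorphM rmorph1.
rewrite /kappa rmorph_sum; apply: eq_bigr => t _.
by rewrite rmorph_sum; apply: eq_bigr => u _; rewrite !coE -rmorphXn -!rmorphM.
Qed.

Lemma stack_nseq j : stack (nseq j Leaf) (nseq j Leaf) = nseq j Leaf.
Proof. by have := stack_nseqr (nseq j Leaf); rewrite size_nseq. Qed.

Theorem theorem3p9 (R : realType) (delta a b : R)
    (hdelta : jones_parameter delta)
    (hab : delta * (a ^+ 2 + b ^+ 2) + 2 * a * b = 1)
    (J : jones_rep delta a%:C b%:C) :
  ~ contains_left_regular (jones_ip J) (jones_pi J) /\
  (forall eta zeta : jones_space J,
     (exists g : thompsonF, jones_ip J (jones_pi J g eta) zeta <> 0) ->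
     ~ c0 (fun g : thompsonF => jones_ip J (jones_pi J g eta) zeta)).
Proof.
have not_c0 : forall eta zeta : jones_space J,
     (exists g : thompsonF, jones_ip J (jones_pi J g eta) zeta <> 0) ->
     ~ c0 (fun g : thompsonF => jones_ip J (jones_pi J g eta) zeta).
  have kappaC T : kappa a b delta T != 0 -> kappa a%:C b%:C delta%:C T != 0.
    by rewrite (kappa_rmorph (real_complex R)) fmorph_eq0.
  have caretE := Phi_caretE (jones_functor J).
  pose Y := Node Leaf Leaf.
  have [/kappaC k0|/kappaC k0] := kappa_neq0 hab.
    (* [A] grows [((.Y).)] and [B] grows [(.(.Y))] at the first root. Both begin with [caret 0 j],
       the common [P0] of [inner_right], whose two sides are [B] and [A] in this order. *)
    pose A j : forest j.+1 (3 + j)%N.+1 := caret 1 j.+1 \of (caret 0 j.+1 \of caret 0 j).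
    pose B j : forest j.+1 (3 + j)%N.+1 := caret 2 j \of (caret 1 j \of caret 0 j).
    apply: (@not_c0_of_local_scalar _ _ _ _ J _
      (Node Leaf Y) Leaf Leaf (Node Leaf Y) 3 A B k0) => //.
    - by move=> j; rewrite /A /= ?take0 ?drop0 !stack_nseq.
    - by move=> j; rewrite /B /= ?take0 ?drop0 !stack_nseq.
    - move=> j x y xs ys; rewrite !span_compA //; try exact: span_comp.
      by exact: (inner_right delta (conj_real a) (conj_real b) x y (caretE 0 j) (caretE 1 j)
        (caretE 2 j) (caretE 0 j.+1) (caretE 1 j.+1)).
  pose A j : forest j.+1 (3 + j)%N.+1 := caret 1 j.+1 \of (caret 1 j \of caret 0 j).
  pose B j : forest j.+1 (3 + j)%N.+1 := caret 0 j.+2 \of (caret 0 j.+1 \of caret 0 j).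
  apply: (@not_c0_of_local_scalar _ _ _ _ J _
    Leaf (Node Y Leaf) (Node Y Leaf) Leaf 3 A B k0) => //.
  - by move=> j; rewrite /A /= ?take0 ?drop0 !stack_nseq.
  - by move=> j; rewrite /B /= ?take0 ?drop0 !stack_nseq.
  - move=> j x y xs ys; rewrite !span_compA //; try exact: span_comp.
    by exact: (inner_left delta (conj_real a) (conj_real b) x y (caretE 0 j) (caretE 0 j.+1)
      (caretE 0 j.+2) (caretE 1 j) (caretE 1 j.+1)).
split=> // /regular_coefficient[eta etaE]; apply: (not_c0 eta eta).
  by exists 1%g; rewrite etaE eqxx; apply/eqP; rewrite oner_eq0.
move=> eps eps0; apply: sub_finite_set (finite_set1 1%g) => g /=.
rewrite etaE; case: eqP => // _; rewrite (_ : cabs _ = 0) ?leNgt ?eps0 //.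
by apply: complexI; rewrite -norm_cabs normr0.
Qed.
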